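(* Let $d\ge1$ and let $\mu$ be the probability measure on $\mathbb{R}^d$ given by $\mathrm{d}\mu(x)=\rho(|x|)\,\mathrm{d}x$ with $\rho:[0,\infty)\to(0,\infty)$ continuous. Then for every $f\in\mathcal{C}_d$ and every closed ball $B$ centered at the origin, $$\int_{\mathbb{R}^d} f\,\mathbf{1}_B\,\mathrm{d}\mu\ \ge\ \Big(\int_{\mathbb{R}^d} f\,\mathrm{d}\mu\Big)\,\mu(B).$$
   Context: $\mathcal{C}_d$ denotes the set of continuous compactly supported functions $f:\mathbb{R}^d\to[0,\infty)$ such that for every $c>0$ the superlevel set $\{x: f(x)>c\}$ is convex, and $f(x)\le f(0)$ for all $x\in\mathbb{R}^d$. *)

(* Defs.v *)
From mathcomp Require Import ssreflect ssrfun ssrbool eqtype ssrnat seq choice fintype finfun bigop.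
From Stdlib Require Import Reals.
Open Scope R_scope.

Definition vnorm (d : nat) (x : 'I_d -> R) : R :=
  sqrt (\big[Rplus/0]_(i < d) (x i * x i)).

Definition vzero (d : nat) : 'I_d -> R := fun _ => 0.

Definition cont_Rd (d : nat) (F : ('I_d -> R) -> R) : Prop :=
  forall x eps, 0 < eps -> exists del, 0 < del /\
    forall y, vnorm d (fun i => y i - x i) < del -> Rabs (F y - F x) < eps.

Definition class_C (d : nat) (f : ('I_d -> R) -> R) : Prop :=
  cont_Rd d f /\
  (exists M, forall x, M < vnorm d x -> f x = 0) /\
  (forall x, 0 <= f x) /\
  (forall c, 0 < c -> forall x y (t : R), c < f x -> c < f y -> 0 <= t <= 1 ->
       c < f (fun i => t * x i + (1 - t) * y i)) /\
  (forall x, f x <= f (vzero d)).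

(* Midpoint Riemann sum of F over the cube [-r,r]^d with n^d equal cells. *)
Definition grid_sum (d : nat) (F : ('I_d -> R) -> R) (r : R) (n : nat) : R :=
  (2 * r / INR n) ^ d *
  \big[Rplus/0]_(k : {ffun 'I_d -> 'I_n})
     F (fun i => - r + (2 * INR (nat_of_ord (k i)) + 1) * r / INR n).

Definition cube_int (d : nat) (F : ('I_d -> R) -> R) (r : R) (I : R) : Prop :=
  Un_cv (fun n => grid_sum d F r (S n)) I.

Definition int_Rd (d : nat) (F : ('I_d -> R) -> R) (I : R) : Prop :=
  forall eps, 0 < eps -> exists R0, forall r, R0 <= r ->
    exists Ir, cube_int d F r Ir /\ Rabs (Ir - I) < eps.

Definition ball_ind (d : nat) (r : R) (x : 'I_d -> R) : R :=
  if Rle_dec (vnorm d x) r then 1 else 0.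

(* Main.v *)
(** The superlevel sets of [f] are star-shaped about the origin, so [f] decreases
    along rays. Hence dilating a shell [{a < |x| <= b}] by a factor [q >= 1]
    multiplies the unweighted integral of [f] over it by at most [q ^ d], while its
    volume is multiplied by exactly [q ^ d]: over geometric shells
    [{r q^i < |x| <= r q^(i+1)}] the averages of [f] decrease in [i]. When [q] is
    close to 1, [rho] is nearly constant on each shell, and the discrete Chebyshev
    inequality gives [(int_(B_s) f dmu) mu(B_r) <= (int_(B_r) f dmu) mu(B_s)] up to
    a vanishing error, for any [s > r] such that [f] vanishes outside [B_s]; finally
    [mu(B_s) <= 1]. Working with shells and dilations replaces polar coordinates:
    midpoint sums over cubes scale exactly. *)

(* The definition of [int_Rd] asks for convergent midpoint sums on every large cube, also for
   integrands that jump across a sphere, so existence of the integrals is a real part of the proof.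
   Continuous compactly supported functions come first; ball indicators are then squeezed between
   radial cutoffs, and the gap is controlled by dilation alone. Chebyshev's inequality is used
   through one number: the average [be] of [f] on the shell just outside radius [r]. Shells inside
   [r] have average at least [be], shells outside at most [be], so both sides are compared with [be]
   times a mass. Two constraints fix the nodes. Both [r] and [s] must be nodes, hence [q] is a root
   of [s / r]. Finitely many geometric shells never reach the origin, so a small innermost ball is
   kept whole and treated as one more piece on which [rho] is nearly constant. The case [r = 0],
   where no geometric nodes exist, is settled by the vanishing volume of a point. *)
From HB Require Import structures.
From Coquelicot Require Import Coquelicot.
Require Import Defs.
From mathcomp Require Import ssreflect ssrfun ssrbool eqtype ssrnat seq choice fintype finfun bigop.
From Stdlib Require Import Reals Lra Lia Classical ClassicalEpsilon FunctionalExtensionality.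
Open Scope R_scope.

Lemma RplusA : associative Rplus.
Proof. by move=> x y z; rewrite Rplus_assoc. Qed.

HB.instance Definition _ :=
  Monoid.isComLaw.Build R 0 Rplus RplusA Rplus_comm Rplus_0_l.

(** * Midpoint sums over cubic grids *)

Lemma sum_le (I : finType) (F G : I -> R) :
  (forall i, F i <= G i) -> \big[Rplus/0]_i F i <= \big[Rplus/0]_i G i.
Proof.
move=> h; apply: (big_ind2 (fun a b => a <= b)) => //; first lra.
by move=> *; lra.
Qed.

Lemma sum_scal (I : finType) (c : R) (F : I -> R) :
  \big[Rplus/0]_i (c * F i) = c * \big[Rplus/0]_i F i.
Proof.
by apply: (big_ind2 (fun a b => a = c * b)) => // [|? ? ? ? -> ->]; ring.
Qed.

Lemma iter_Rplus (n : nat) (c : R) : iter n (Rplus c) 0 = INR n * c.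
Proof.
elim: n => [|n ih]; first by rewrite /=; ring.
by rewrite S_INR iterS ih; ring.
Qed.

Lemma sum_const (I : finType) (c : R) : \big[Rplus/0]_(i : I) c = INR #|I| * c.
Proof. by rewrite big_const iter_Rplus. Qed.

Lemma INR_expn (m n : nat) : INR (expn m n) = INR m ^ n.
Proof. by elim: n => [|n ih] //=; rewrite expnS mult_INR ih. Qed.

Lemma le_INR_S (a : R) : exists N : nat, forall n, (N <= n)%nat -> a <= INR n.
Proof.
case: (nfloor_ex (Rmax a 0) (Rmax_r _ _)) => N [h1 h2].
exists N.+1 => n /leP /le_INR; rewrite S_INR.
by have := Rmax_l a 0; lra.
Qed.

Definition grid_pt {d n : nat} (r : R) (k : {ffun 'I_d -> 'I_n}) : 'I_d -> R :=
  fun i => - r + (2 * INR (k i) + 1) * r / INR n.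

Lemma grid_pt_in {d n : nat} (r : R) (k : {ffun 'I_d -> 'I_n}) (i : 'I_d) :
  0 <= r -> Rabs (grid_pt r k i) <= r.
Proof.
move=> hr; rewrite /grid_pt.
have hk : (INR (k i) + 1 <= INR n).
  by rewrite -S_INR; apply: le_INR; apply/leP; exact: ltn_ord.
have h0 := pos_INR (k i).
have hn : 0 < INR n by lra.
have -> : - r + (2 * INR (k i) + 1) * r / INR n
  = r * ((2 * INR (k i) + 1 - INR n) / INR n) by field; lra.
rewrite Rabs_mult (Rabs_pos_eq r) //.
have : Rabs ((2 * INR (k i) + 1 - INR n) / INR n) <= 1; last by nra.
rewrite Rabs_div; last lra.
rewrite (Rabs_pos_eq (INR n)); last lra.
apply/Rle_div_l; first lra.
by apply: Rabs_le; lra.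
Qed.

Lemma cell_pow_ge0 (d n : nat) (r : R) : 0 <= r -> 0 <= (2 * r / INR n) ^ d.
Proof.
move=> hr; apply: pow_le; case: n => [|n]; last first.
  by apply: Rdiv_le_0_compat; [lra | apply: lt_0_INR; lia].
by rewrite /Rdiv Rinv_0; lra.
Qed.

Lemma grid_sum_le {d : nat} (F G : ('I_d -> R) -> R) (r : R) (n : nat) :
  0 <= r -> (forall x, (forall i, Rabs (x i) <= r) -> F x <= G x) ->
  grid_sum d F r n <= grid_sum d G r n.
Proof.
move=> hr h; apply: Rmult_le_compat_l; first exact: cell_pow_ge0.
by apply: sum_le => k; apply: h => i; exact: (grid_pt_in r k i hr).
Qed.

Lemma grid_sum_lin {d : nat} (F G : ('I_d -> R) -> R) (a b r : R) (n : nat) :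
  grid_sum d (fun x => a * F x + b * G x) r n
  = a * grid_sum d F r n + b * grid_sum d G r n.
Proof.
rewrite /grid_sum big_split !sum_scal.
have h (s u v : R) : s * (a * u + b * v) = a * (s * u) + b * (s * v) by ring.
exact: h.
Qed.

Lemma grid_sum_const (d : nat) (c r : R) (n : nat) :
  grid_sum d (fun _ => c) r n.+1 = (2 * r) ^ d * c.
Proof.
rewrite /grid_sum sum_const card_ffun !card_ord INR_expn -Rmult_assoc.
rewrite -Rpow_mult_distr; congr (_ ^ _ * _). field.
exact: not_0_INR.
Qed.

Lemma grid_sum_scale {d : nat} (F : ('I_d -> R) -> R) (l r : R) (n : nat) :
  grid_sum d F (l * r) n
  = l ^ d * grid_sum d (fun x => F (fun i => l * x i)) r n.
Proof.
have e : 2 * (l * r) / INR n = l * (2 * r / INR n) by rewrite /Rdiv; ring.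
rewrite /grid_sum e Rpow_mult_distr Rmult_assoc; congr (_ * (_ * _)).
apply: eq_bigr => k _; congr F; apply: functional_extensionality => i.
by rewrite /Rdiv; ring.
Qed.

Lemma grid_sum_close {d : nat} (F G : ('I_d -> R) -> R) (r e : R) (n : nat) :
  0 <= r -> (forall x, (forall i, Rabs (x i) <= r) -> Rabs (F x - G x) <= e) ->
  Rabs (grid_sum d F r n.+1 - grid_sum d G r n.+1) <= (2 * r) ^ d * e.
Proof.
move=> hr h; have hc c := grid_sum_const d c r n.
have h1 : grid_sum d F r n.+1 <= grid_sum d (fun x => 1 * G x + 1 * e) r n.+1.
  by apply: grid_sum_le => // x hx; have /Rabs_le_between := h x hx; lra.
have h2 : grid_sum d G r n.+1 <= grid_sum d (fun x => 1 * F x + 1 * e) r n.+1.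
  by apply: grid_sum_le => // x hx; have /Rabs_le_between := h x hx; lra.
move: h1 h2; rewrite !grid_sum_lin !hc => h1 h2; apply: Rabs_le; lra.
Qed.

Lemma refine_ord_proof (n m : nat) (j : 'I_n) (l : 'I_m) : (j * m + l < n * m)%nat.
Proof.
have := ltn_ord l; have := ltn_ord j => hj hl.
apply: (@leq_trans (j.+1 * m)%nat); first by rewrite mulSn addnC ltn_add2r.
by rewrite leq_mul2r hj orbT.
Qed.

Definition refine_ord {n m : nat} (j : 'I_n) (l : 'I_m) : 'I_(n * m) :=
  Ordinal (refine_ord_proof n m j l).

Lemma refine_ord_inj {n m : nat} (j j' : 'I_n) (l l' : 'I_m) :
  refine_ord j l = refine_ord j' l' -> j = j' /\ l = l'.
Proof.
move=> /(congr1 val) /= h.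
have hl := ltn_ord l; have hl' := ltn_ord l'.
have e : (j : nat) = j'.
  move/ltP: hl => hl; move/ltP: hl' => hl'; move: h.
  rewrite -!plusE -!multE; nia.
split; first exact: val_inj.
by apply: val_inj; move: h; rewrite /= e; apply: addnI.
Qed.

(* A grid with n cells per side is compared with its subdivision into n * m
   cells per side; two arbitrary grids are then compared through a common
   subdivision. *)
Lemma grid_sum_refine {d : nat} (F : ('I_d -> R) -> R) (r e : R) (n m : nat) :
  0 <= r -> (0 < n)%nat -> (0 < m)%nat ->
  (forall x y, (forall i, Rabs (x i - y i) <= r / INR n) ->
     Rabs (F x - F y) <= e) ->
  Rabs (grid_sum d F r n - grid_sum d F r (n * m)) <= (2 * r) ^ d * e.
Proof.
move=> hr hn hm hF.
have hn' : 0 < INR n by apply: lt_0_INR; apply/ltP.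
have hm' : 0 < INR m by apply: lt_0_INR; apply/ltP.
pose h (p : {ffun 'I_d -> 'I_n} * {ffun 'I_d -> 'I_m}) :
    {ffun 'I_d -> 'I_(n * m)} := [ffun i => refine_ord (p.1 i) (p.2 i)].
have hinj : injective h.
  move=> [j l] [j' l'] /ffunP /= E; congr pair; apply/ffunP => i;
    by have := E i; rewrite !ffunE /= => /refine_ord_inj [].
have hbij : bijective h.
  apply: inj_card_bij => //.
  by rewrite card_prod !card_ffun !card_ord expnMn.
have hS : grid_sum d F r (n * m) = (2 * r / INR (n * m)) ^ d *
   \big[Rplus/0]_(j : {ffun 'I_d -> 'I_n})
     \big[Rplus/0]_(l : {ffun 'I_d -> 'I_m}) F (grid_pt r (h (j, l))).
  rewrite /grid_sum; congr (_ * _).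
  rewrite (pair_bigA _ (fun j l => F (grid_pt r (h (j, l))))) /=.
  rewrite (reindex h); last exact: onW_bij.
  by apply: eq_bigr => -[j l] _.
(* Counting each coarse value once per subcell puts both sums over the same pairs [(j, l)] with the
   same cell volume. *)
have hA : grid_sum d F r n = (2 * r / INR (n * m)) ^ d *
   \big[Rplus/0]_(j : {ffun 'I_d -> 'I_n})
     \big[Rplus/0]_(l : {ffun 'I_d -> 'I_m}) F (grid_pt r j).
  under eq_bigr => j _ do rewrite sum_const card_ffun !card_ord INR_expn.
  rewrite sum_scal -Rmult_assoc -Rpow_mult_distr /grid_sum mult_INR.
  by congr (_ ^ _ * _); field; lra.
(* A subcell midpoint lies in the coarse cell, hence within half its side, [r / INR n], of the
   coarse midpoint. *)
have hcl (j : {ffun 'I_d -> 'I_n}) (l : {ffun 'I_d -> 'I_m}) :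
    Rabs (F (grid_pt r j) - F (grid_pt r (h (j, l)))) <= e.
  apply: hF => i; rewrite /grid_pt ffunE /= plus_INR !mult_INR.
  have h1 := pos_INR (l i).
  have h2 : INR (l i) + 1 <= INR m.
    by rewrite -S_INR; apply: le_INR; apply/leP; exact: ltn_ord.
  have -> : - r + (2 * INR (j i) + 1) * r / INR n -
   (- r + (2 * (INR (j i) * INR m + INR (l i)) + 1) * r / (INR n * INR m))
    = r / INR n * ((INR m - 2 * INR (l i) - 1) / INR m) by field; lra.
  have h3 : 0 <= r / INR n by apply: Rdiv_le_0_compat.
  rewrite Rabs_mult (Rabs_pos_eq (r / INR n)) //.
  have : Rabs ((INR m - 2 * INR (l i) - 1) / INR m) <= 1; last by nra.
  rewrite Rabs_div; last lra.
  rewrite (Rabs_pos_eq (INR m)); last lra.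
  by apply/Rle_div_l; first lra; apply: Rabs_le; lra.
have hpow : (2 * r / INR (n * m)) ^ d * (INR n ^ d * (INR m ^ d * e))
   = (2 * r) ^ d * e.
  rewrite -!Rmult_assoc -!Rpow_mult_distr mult_INR; congr (_ ^ _ * _).
  by field; lra.
have hc := cell_pow_ge0 d (n * m) r hr.
have hce : \big[Rplus/0]_(j : {ffun 'I_d -> 'I_n})
     \big[Rplus/0]_(l : {ffun 'I_d -> 'I_m}) e = INR n ^ d * (INR m ^ d * e).
  by rewrite !sum_const !card_ffun !card_ord !INR_expn.
rewrite -hpow -hce hA hS.
apply: Rabs_le; split.
- suff : \big[Rplus/0]_(j : {ffun 'I_d -> 'I_n})
     \big[Rplus/0]_(l : {ffun 'I_d -> 'I_m}) F (grid_pt r (h (j, l)))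
   <= \big[Rplus/0]_(j : {ffun 'I_d -> 'I_n})
     \big[Rplus/0]_(l : {ffun 'I_d -> 'I_m}) (F (grid_pt r j))
   + \big[Rplus/0]_(j : {ffun 'I_d -> 'I_n})
     \big[Rplus/0]_(l : {ffun 'I_d -> 'I_m}) e by nra.
  rewrite -big_split /=; apply: sum_le => j; rewrite -big_split /=.
  by apply: sum_le => l; have /Rabs_le_between := hcl j l; lra.
- suff : \big[Rplus/0]_(j : {ffun 'I_d -> 'I_n})
     \big[Rplus/0]_(l : {ffun 'I_d -> 'I_m}) F (grid_pt r j)
   <= \big[Rplus/0]_(j : {ffun 'I_d -> 'I_n})
     \big[Rplus/0]_(l : {ffun 'I_d -> 'I_m}) F (grid_pt r (h (j, l)))
   + \big[Rplus/0]_(j : {ffun 'I_d -> 'I_n})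
     \big[Rplus/0]_(l : {ffun 'I_d -> 'I_m}) e by nra.
  rewrite -big_split /=; apply: sum_le => j; rewrite -big_split /=.
  by apply: sum_le => l; have /Rabs_le_between := hcl j l; lra.
Qed.

(** * Integrals of compactly supported continuous functions *)

Definition ucont {d : nat} (F : ('I_d -> R) -> R) : Prop :=
  forall e, 0 < e -> exists del, 0 < del /\
    forall x y, (forall i, Rabs (x i - y i) <= del) -> Rabs (F x - F y) <= e.

Definition csupp {d : nat} (r : R) (F : ('I_d -> R) -> R) : Prop :=
  forall x, (exists i, r < Rabs (x i)) -> F x = 0.

(* Walk from [x] to the origin in steps of bounded sup-length. *)
Lemma ucont_csupp_bounded {d : nat} (F : ('I_d -> R) -> R) (r : R) :
  0 < r -> ucont F -> csupp r F -> exists B, 0 <= B /\ forall x, Rabs (F x) <= B.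
Proof.
move=> hr hu hs; case: (hu 1 Rlt_0_1) => del [hdel hF].
case: (le_INR_S (r / del)) => N0 /(_ N0.+1 (leqnSn _)).
set N := N0.+1 => hN.
have hN0 : 0 < INR N by apply: lt_0_INR; lia.
have step (x : 'I_d -> R) : (forall i, Rabs (x i) <= r) -> forall k : nat,
    Rabs (F (fun i => INR k / INR N * x i) - F (fun _ => 0)) <= INR k.
  move=> hx; elim=> [|k ih].
    rewrite (_ : (fun i => INR 0 / INR N * x i) = (fun _ => 0)).
      by rewrite Rminus_diag Rabs_R0 /=; lra.
    by apply: functional_extensionality => i; rewrite (_ : INR 0 = 0) //; field; lra.
  have h1 : Rabs (F (fun i => INR k.+1 / INR N * x i)
      - F (fun i => INR k / INR N * x i)) <= 1.
    apply: hF => i; rewrite S_INR.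
    have -> : (INR k + 1) / INR N * x i - INR k / INR N * x i = x i / INR N.
      by field; lra.
    rewrite Rabs_div; last lra.
    rewrite (Rabs_pos_eq (INR N)); last lra.
    apply/Rle_div_l => //.
    by move: hN => /Rle_div_l h; have := h hdel; have := hx i; lra.
  move/Rabs_le_between: h1 => h1; move/Rabs_le_between: ih => ih.
  by rewrite [X in _ <= X]S_INR; apply: Rabs_le; lra.
exists (INR N + Rabs (F (fun _ => 0))); split.
  by have := Rabs_pos (F (fun _ => 0)); lra.
move=> x; case: (classic (exists i, r < Rabs (x i))) => [/hs ->|hx].
  by rewrite Rabs_R0; have := Rabs_pos (F (fun _ => 0)); lra.
have hx' i : Rabs (x i) <= r.
  by case: (Rle_lt_dec (Rabs (x i)) r) => // h; case: hx; exists i.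
have := step x hx' N.
rewrite (_ : (fun i => INR N / INR N * x i) = x); last first.
  by apply: functional_extensionality => i; field; lra.
move=> h; have := Rabs_triang (F x - F (fun _ => 0)) (F (fun _ => 0)).
by rewrite (_ : F x - F (fun _ => 0) + F (fun _ => 0) = F x); [lra | ring].
Qed.

Lemma grid_sum_cv {d : nat} (F : ('I_d -> R) -> R) (r : R) :
  0 < r -> ucont F -> exists I, cube_int d F r I.
Proof.
move=> hr hu; suff /R_complete [I hI] :
  Cauchy_crit (fun n => grid_sum d F r n.+1) by exists I.
move=> eps heps.
have hV : 0 < (2 * r) ^ d by apply: pow_lt; lra.
(* Each of the two comparisons with the common subdivision costs [eps / 3], which leaves the sum
   strictly below [eps]. *)
pose e := eps / (3 * (2 * r) ^ d).
have he : 0 < e by apply: Rdiv_lt_0_compat; lra.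
case: (hu e he) => del [hdel hF].
case: (le_INR_S (r / del)) => N hN.
have key n m : (N <= n)%nat ->
  Rabs (grid_sum d F r n.+1 - grid_sum d F r (n.+1 * m.+1)) <= (2 * r) ^ d * e.
  move=> hn; apply: grid_sum_refine => //; first lra.
  move=> x y hxy; apply: hF => i; apply: (Rle_trans _ _ _ (hxy i)).
  have h0 : 0 < INR n.+1 by apply: lt_0_INR; lia.
  apply/Rle_div_l => //.
  by have /Rle_div_l := hN n.+1 (leqW hn) => /(_ hdel); lra.
exists N => n m /leP hn /leP hm; rewrite /Rdist.
have h1 := key n m hn; have := key m n hm; rewrite mulnC.
have e3 : (2 * r) ^ d * e = eps / 3 by rewrite /e; field; lra.
move: h1; rewrite e3 => /Rabs_le_between h1 /Rabs_le_between h2.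
by apply/Rabs_lt_between; lra.
Qed.

(** Adding [j] layers of cells on every side keeps the cell size and the old midpoints; the new
    midpoints fall outside the cube, where [F] vanishes. *)
Lemma grid_sum_enlarge {d : nat} (F : ('I_d -> R) -> R) (r : R) (n j : nat) :
  0 < r -> csupp r F ->
  grid_sum d F (r * INR (n.+1 + 2 * j) / INR n.+1) (n.+1 + 2 * j)
  = grid_sum d F r n.+1.
Proof.
move=> hr hs; set N := (n.+1 + 2 * j)%nat.
have hn : 0 < INR n.+1 by apply: lt_0_INR; lia.
have hNE : INR N = INR n.+1 + 2 * INR j by rewrite plus_INR mult_INR.
have hj := pos_INR j.
have hN : 0 < INR N by lra.
rewrite /grid_sum; congr (_ ^ _ * _); first by field; lra.
have hlt (k : 'I_n.+1) : (k + j < N)%nat.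
  have := ltn_ord k; rewrite /N => /ltP h; apply/ltP.
  by rewrite -plusE -multE; lia.
pose h (k : {ffun 'I_d -> 'I_n.+1}) : {ffun 'I_d -> 'I_N} :=
  [ffun i => Ordinal (hlt (k i))].
pose h' (k : {ffun 'I_d -> 'I_N}) : {ffun 'I_d -> 'I_n.+1} :=
  [ffun i => inord (k i - j)].
pose P (k : {ffun 'I_d -> 'I_N}) := [forall i, (j <= k i < n.+1 + j)%nat].
(* [P] selects the old cells, whose indices are all shifted by [j]; the border cells contribute
   0. *)
rewrite (bigID P) [X in _ + X = _]big1 ?Rplus_0_r; last first.
  move=> k /forallPn /= [i hi]; apply: hs; exists i.
  have -> : - (r * INR N / INR n.+1) + (2 * INR (k i) + 1) * (r * INR N / INR n.+1) / INR N
    = r * ((2 * (INR (k i) - INR j) + 1) / INR n.+1 - 1).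
    by rewrite hNE; field; lra.
  rewrite Rabs_mult (Rabs_pos_eq r); last lra.
  suff : 1 < Rabs ((2 * (INR (k i) - INR j) + 1) / INR n.+1 - 1) by nra.
  move: hi; rewrite negb_and -!ltnNge ltnS => /orP [].
    move=> /ltP /le_INR; rewrite S_INR => hi.
    have : (2 * (INR (k i) - INR j) + 1) / INR n.+1 < 0; last first.
      move=> hneg; rewrite -Rabs_Ropp; apply: Rlt_le_trans (Rle_abs _); lra.
    by apply/Rlt_div_l => //; lra.
  move=> /leP /le_INR; rewrite -plusE plus_INR => hi; apply: Rlt_le_trans (Rle_abs _).
  suff : 2 < (2 * (INR (k i) - INR j) + 1) / INR n.+1 by lra.
  by apply/Rlt_div_r => //; lra.
(* [h'] inverts the shift [h] only on [P]; elsewhere the default of [inord] is harmless. *)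
rewrite (reindex_onto h h'); last first.
  move=> k /forallP hk; apply/ffunP => i; apply: val_inj.
  rewrite !ffunE /=; case/andP: (hk i) => h1 h2.
  by rewrite inordK ?subnK // ltn_subLR // addnC.
apply: eq_big => [k|k _].
  apply/andP; split; first by apply/forallP => i; rewrite ffunE /= leq_addl ltn_add2r ltn_ord.
  apply/eqP/ffunP => i; apply: val_inj; rewrite !ffunE /= addnK inordK //.
congr F; apply: functional_extensionality => i.
have e (a : R) : - (r * INR N / INR n.+1) +
    (2 * (a + INR j) + 1) * (r * INR N / INR n.+1) / INR N
    = - r + (2 * a + 1) * r / INR n.+1 by rewrite hNE; field; lra.
by rewrite ffunE [val _]/(k i + j)%nat plus_INR; exact: e.
Qed.

(** Bernoulli's inequality: a dilation by [m] near 1 changes volumes by a factor near 1. *)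
Lemma pow_ge_linear (m : R) (d : nat) :
  0 <= m <= 1 -> 1 - INR d * (1 - m) <= m ^ d <= 1.
Proof.
move=> hm; elim: d => [|d ih]; first by rewrite /=; lra.
rewrite S_INR -tech_pow_Rmult; have := pos_INR d; nra.
Qed.

(* The side [r'] is nearly [r * (n + 2j) / n] for a suitable [j], and the grid
   of that size with n + 2j cells per side extends the grid of [r] with n. *)
Lemma cube_int_indep {d : nat} (F : ('I_d -> R) -> R) (r r' I I' : R) :
  0 < r <= r' -> ucont F -> csupp r F ->
  cube_int d F r I -> cube_int d F r' I' -> I = I'.
Proof.
move=> [hr hrr'] hu hs hI hI'.
case: (ucont_csupp_bounded F r hr hu hs) => B [hB0 hB].
have hV : 0 < (2 * r') ^ d by apply: pow_lt; lra.
have hd := pos_INR d.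
suff key : forall e, 0 < e -> Rabs (I - I') <= e * (2 + (2 * r') ^ d * (B + 1)).
  apply: cond_eq => e he.
  have hC : 0 < 2 + (2 * r') ^ d * (B + 1) by nra.
  have := key (e / (2 * (2 + (2 * r') ^ d * (B + 1)))) _.
  have -> : e / (2 * (2 + (2 * r') ^ d * (B + 1))) * (2 + (2 * r') ^ d * (B + 1))
     = e / 2 by field; lra.
  move=> h; apply: Rle_lt_trans (h _) _; last lra.
  by apply: Rdiv_lt_0_compat; lra.
move=> e he.
case: (hu e he) => del [hdel hF].
case: (hI e he) => N1 hN1; case: (hI' e he) => N2 hN2.
case: (le_INR_S (2 * r / del)) => N3 hN3.
case: (le_INR_S (2 * INR d / e)) => N4 hN4.
(* [N1] and [N2] bring the sums near their limits, [N3] makes the dilation below move points by at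
   most [del], and [N4] makes it change volumes by a factor within [e] of 1. *)
pose n := (N1 + N2 + N3 + N4)%coq_nat.
have hn : 0 < INR n.+1 by apply: lt_0_INR; lia.
have h3 : 2 * r / INR n.+1 <= del.
  apply/Rle_div_l => //.
  have hNn : (N3 <= n.+1)%nat by apply/leP; rewrite /n -?plusE; lia.
  by have /Rle_div_l := hN3 n.+1 hNn => /(_ hdel); lra.
have h4 : INR d * (2 / INR n.+1) <= e.
  have -> : INR d * (2 / INR n.+1) = 2 * INR d / INR n.+1 by field; lra.
  apply/Rle_div_l => //.
  have hNn : (N4 <= n.+1)%nat by apply/leP; rewrite /n -?plusE; lia.
  by have /Rle_div_l := hN4 n.+1 hNn => /(_ he); lra.
have hx0 : 0 <= INR n.+1 * (r' / r - 1) / 2.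
  have : 1 <= r' / r by apply/Rle_div_r; lra.
  by nra.
(* This is the largest [j] for which the enlarged cube stays inside the one of half-side [r']; the
   half-sides then differ by less than [2 * r / INR n.+1]. *)
case: (nfloor_ex _ hx0) => j [hj1 hj2].
pose N := (n.+1 + 2 * j)%nat.
have hNE : INR N = INR n.+1 + 2 * INR j by rewrite plus_INR mult_INR.
have hj := pos_INR j.
pose m := r * INR N / INR n.+1 / r'.
have hm : 1 - 2 / INR n.+1 <= m <= 1.
  have er : r' = r * (r' / r) by field; lra.
  have hq : 1 <= r' / r by apply/Rle_div_r; lra.
  have -> : m = INR N / (INR n.+1 * (r' / r)).
    by rewrite /m; field; lra.
  have hp : 0 < INR n.+1 * (r' / r) by nra.
  split; last by apply/Rle_div_l => //; lra.
  apply/Rle_div_r => //.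
  have -> : (1 - 2 / INR n.+1) * (INR n.+1 * (r' / r))
    = INR n.+1 * (r' / r) - 2 * (r' / r) by field; lra.
  lra.
have hm0 : 0 <= m.
  by rewrite /m hNE; do 2 (apply: Rdiv_le_0_compat; last lra); nra.
have hmd := pow_ge_linear m d (conj hm0 (proj2 hm)).
have hS : grid_sum d F r n.+1
   = m ^ d * grid_sum d (fun x => F (fun i => m * x i)) r' N.
  rewrite -(grid_sum_enlarge F r n j hr hs) -grid_sum_scale.
  by congr grid_sum; rewrite -/N /m; field; lra.
have [N' eN] : exists N', N = N'.+1 by exists (n + 2 * j)%nat.
have hN1' : Rabs (grid_sum d F r n.+1 - I) < e by apply: hN1; rewrite /n -?plusE; lia.
have hN2' : Rabs (grid_sum d F r' N - I') < e.
  rewrite eN; apply: hN2; move: eN; rewrite /N -plusE -multE => -[<-].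
  by rewrite /n -?plusE; lia.
(* On the cube the dilation by [m] displaces each coordinate by at most [(1 - m) * r'], which is at
   most [del]. *)
have c1 : Rabs (grid_sum d (fun x => F (fun i => m * x i)) r' N
   - grid_sum d F r' N) <= (2 * r') ^ d * e.
  rewrite eN; apply: grid_sum_close => [|x hx]; first lra.
  apply: hF => i; have -> : m * x i - x i = - ((1 - m) * x i) by ring.
  rewrite Rabs_Ropp Rabs_mult Rabs_pos_eq; last lra.
  have hc : r * (2 / INR n.+1) <= del.
    by apply: Rle_trans h3; right; rewrite /Rdiv; ring.
  have hq : 1 <= r' / r by apply/Rle_div_r; lra.
  have h1m : (1 - m) * r' <= r * (2 / INR n.+1).
    have -> : (1 - m) * r' = r * ((INR n.+1 * (r' / r) - INR N) / INR n.+1).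
      by rewrite /m; field; lra.
    apply: Rmult_le_compat_l; first lra.
    by apply: Rmult_le_compat_r; [apply/Rlt_le/Rinv_0_lt_compat | lra].
  have := hx i; have := Rabs_pos (x i); nra.
have c2 : Rabs (grid_sum d F r' N) <= (2 * r') ^ d * B.
  have : Rabs (grid_sum d F r' N - grid_sum d (fun _ => 0) r' N) <= (2 * r') ^ d * B.
    by rewrite eN; apply: grid_sum_close => [|x _]; [lra | rewrite Rminus_0_r].
  by rewrite eN grid_sum_const Rmult_0_r Rminus_0_r.
move: hN1' hN2' c1 c2; rewrite hS.
set S1 := grid_sum _ _ _ _; set S2 := grid_sum _ _ _ _.
move=> /Rabs_lt_between b1 /Rabs_lt_between b2 b3 b4.
have b5 : Rabs (m ^ d * S1 - S2) <= e * ((2 * r') ^ d * (B + 1)).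
  have -> : m ^ d * S1 - S2 = m ^ d * (S1 - S2) + - ((1 - m ^ d) * S2) by ring.
  apply: Rle_trans (Rabs_triang _ _) _.
  have hmp : 0 <= m ^ d by apply: pow_le.
  rewrite Rabs_Ropp (Rabs_mult (m ^ d)) (Rabs_mult (1 - m ^ d)).
  rewrite (Rabs_pos_eq (m ^ d)) // (Rabs_pos_eq (1 - m ^ d)); last lra.
  have he' : 1 - m ^ d <= e.
    have : INR d * (1 - m) <= INR d * (2 / INR n.+1) by apply: Rmult_le_compat_l; lra.
    lra.
  have p1 := Rabs_pos (S1 - S2); have p2 := Rabs_pos S2.
  have q1 : m ^ d * Rabs (S1 - S2) <= 1 * Rabs (S1 - S2).
    by apply: Rmult_le_compat_r; lra.
  have q2 : (1 - m ^ d) * Rabs S2 <= e * ((2 * r') ^ d * B).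
    by apply: Rmult_le_compat => //; lra.
  lra.
move/Rabs_le_between: b5 => b5.
by apply: Rabs_le; lra.
Qed.

Lemma ucont_csupp_int {d : nat} (F : ('I_d -> R) -> R) (r0 : R) :
  0 < r0 -> ucont F -> csupp r0 F ->
  exists I, forall r, r0 <= r -> cube_int d F r I.
Proof.
move=> hr0 hu hs; case: (grid_sum_cv F r0 hr0 hu) => I hI; exists I => r hr.
have hr' : 0 < r by lra.
case: (grid_sum_cv F r hr' hu) => I' hI'.
by rewrite (cube_int_indep F r0 r I I').
Qed.

(** * Continuity and cutoffs *)

(* Continuity for the sup-norm uniform structure on ['I_d -> R]. *)
Definition scont {d : nat} (F : ('I_d -> R) -> R) : Prop :=
  forall x, continuous (F : fct_UniformSpace 'I_d R_UniformSpace -> R_UniformSpace) x.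

Lemma scontP {d : nat} (F : ('I_d -> R) -> R) :
  scont F <-> forall x e, 0 < e -> exists del, 0 < del /\
    forall y, (forall i, Rabs (y i - x i) < del) -> Rabs (F y - F x) < e.
Proof.
split=> hF x.
  move=> e he; have /filterlim_locally := hF x => /(_ (mkposreal e he)) [del hdel].
  by exists del; split; [exact: cond_pos | move=> y hy; apply: hdel].
apply/filterlim_locally => e.
have [del [hdel h]] := hF x e (cond_pos e).
by exists (mkposreal del hdel) => y hy; apply: h.
Qed.

(** Coquelicot states compactness of boxes for the nested tuples [Tn n R], while points here are
    functions on ['I_d]; [tn_nth] and [tn_of] translate between the two. *)
Fixpoint tn_nth (n : nat) : Compactness.Tn n R -> nat -> R :=
  match n with
  | O => fun _ _ => 0
  | S n' => fun v i => match i with O => fst v | S i' => tn_nth n' (snd v) i' end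
  end.

Fixpoint tn_of (n : nat) (x : nat -> R) : Compactness.Tn n R :=
  match n with
  | O => tt
  | S n' => (x 0%nat, tn_of n' (fun i => x (S i)))
  end.

Lemma tn_nth_of (n : nat) (x : nat -> R) (i : nat) :
  (i < n)%nat -> tn_nth n (tn_of n x) i = x i.
Proof. by elim: n x i => [|n ih] x [|i] //= hi; rewrite ih. Qed.

Lemma tn_bounded (n : nat) (r : R) (x : nat -> R) :
  (forall i, (i < n)%nat -> Rabs (x i) <= r) ->
  bounded_n n (tn_of n (fun _ => - r)) (tn_of n (fun _ => r)) (tn_of n x).
Proof.
elim: n x => [|n ih] x hx //=; split; last by apply: ih => i hi; apply: hx.
by have /Rabs_le_between := hx 0%nat (ltn0Sn _).
Qed.

Lemma tn_close (n : nat) (e : R) (x t : Compactness.Tn n R) (i : nat) :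
  close_n n e x t -> (i < n)%nat -> Rabs (tn_nth n x i - tn_nth n t i) < e.
Proof.
elim: n x t i => [|n ih] // [x0 x] [t0 t] [|i] //= [h1 h2] // hi.
exact: ih.
Qed.

(** Heine-Cantor on a box. Only [x] is confined to the box, so that pairs straddling its boundary
    are covered too. *)
Lemma scont_ucont_on {d : nat} (F : ('I_d -> R) -> R) (r e : R) :
  scont F -> 0 < e -> exists del, 0 < del /\ forall x y,
    (forall i, Rabs (x i) <= r) -> (forall i, Rabs (x i - y i) <= del) ->
    Rabs (F x - F y) <= e.
Proof.
move=> /scontP hF he.
(* The estimate holds up to twice the gauge: [x] will be within [delta t] of [t], and [y] a little
   further away. *)
have h2 (t : Compactness.Tn d R) : exists del : posreal,
    forall y, (forall i : 'I_d, Rabs (y i - tn_nth d t i) < 2 * del) ->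
    Rabs (F y - F (fun i => tn_nth d t i)) < e / 2.
  case: (hF (fun i => tn_nth d t i) (e / 2)) => [|del [hdel h]]; first lra.
  have hd2 : 0 < del / 2 by lra.
  exists (mkposreal _ hd2) => y hy; apply: h => i; have /= := hy i; lra.
pose delta t := proj1_sig (constructive_indefinite_description _ (h2 t)).
have hdelta t : forall y, (forall i : 'I_d, Rabs (y i - tn_nth d t i) < 2 * delta t) ->
    Rabs (F y - F (fun i => tn_nth d t i)) < e / 2.
  exact: (proj2_sig (constructive_indefinite_description _ (h2 t))).
case: (compactness_value d (tn_of d (fun _ => - r)) (tn_of d (fun _ => r)) delta)
  => del hdel.
have h0 := cond_pos del.
exists (del / 2); split=> [|x y hx hxy]; first lra.
pose x' (i : nat) := if insub i is Some j then x j else 0.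
have ex (i : 'I_d) : tn_nth d (tn_of d x') i = x i.
  by rewrite tn_nth_of // /x' valK.
have /hdel : bounded_n d (tn_of d (fun _ => - r)) (tn_of d (fun _ => r)) (tn_of d x').
  apply: tn_bounded => i hi; rewrite /x' insubT; exact: hx.
(* [compactness_value] yields its tag point [t] only under a double negation, so the inequality is
   proved by contradiction. *)
move=> h; apply: Rnot_lt_le => hlt; apply: h => -[t [_ [hc hd]]].
have c1 : forall i : 'I_d, Rabs (x i - tn_nth d t i) < delta t.
  by move=> i; rewrite -ex; apply: tn_close.
have b1 : Rabs (F x - F (fun i => tn_nth d t i)) < e / 2.
  by apply: hdelta => i; have := c1 i; have := cond_pos (delta t); lra.
have b2 : Rabs (F y - F (fun i => tn_nth d t i)) < e / 2.
  apply: hdelta => i; apply/Rabs_lt_between.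
  have /Rabs_lt_between := c1 i; have /Rabs_le_between := hxy i; lra.
move/Rabs_lt_between: b1 => b1; move/Rabs_lt_between: b2 => b2.
by move: hlt; apply: Rle_not_lt; apply: Rabs_le; lra.
Qed.

Lemma scont_csupp_ucont {d : nat} (F : ('I_d -> R) -> R) (r : R) :
  scont F -> csupp r F -> ucont F.
Proof.
move=> hc hs e he.
(* The margin 1 and a step of at most 1 ensure that if [x] leaves the larger box, then [y] is
   outside the support as well. *)
case: (scont_ucont_on F (r + 1) e hc he) => del [hdel h].
exists (Rmin del 1); split; first by apply: Rmin_glb_lt; lra.
move=> x y hxy; have m1 := Rmin_l del 1; have m2 := Rmin_r del 1.
case: (classic (exists i, r + 1 < Rabs (x i))) => [[i hi]|hx]; last first.
  apply: h => i; last by have := hxy i; lra.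
  by apply: Rnot_lt_le => hi; apply: hx; exists i.
rewrite hs; last by exists i; lra.
rewrite hs ?Rminus_diag ?Rabs_R0; first lra.
exists i; have := hxy i; have := Rabs_triang_inv (x i) (y i); lra.
Qed.

Lemma scont_ext {d : nat} (F G : ('I_d -> R) -> R) :
  (forall x, F x = G x) -> scont F -> scont G.
Proof. by move=> /functional_extensionality ->. Qed.

Lemma scont_const (d : nat) (c : R) : scont (fun _ : 'I_d -> R => c).
Proof. by move=> x; apply: continuous_const. Qed.

Lemma scont_plus {d : nat} (F G : ('I_d -> R) -> R) :
  scont F -> scont G -> scont (fun x => F x + G x).
Proof. by move=> hF hG x; apply: continuous_plus; [apply: hF | apply: hG]. Qed.

Lemma scont_mult {d : nat} (F G : ('I_d -> R) -> R) :
  scont F -> scont G -> scont (fun x => F x * G x).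
Proof.
move=> hF hG x.
by apply: (@continuous_mult _ R_AbsRing); [apply: hF | apply: hG].
Qed.

Lemma scont_comp {d : nat} (F : ('I_d -> R) -> R) (u : R -> R) :
  scont F -> (forall x, continuous u (F x)) -> scont (fun x => u (F x)).
Proof. by move=> hF hu x; apply: continuous_comp => //; apply: hF. Qed.

Lemma scont_coord {d : nat} (i : 'I_d) : scont (fun x => x i).
Proof. by apply/scontP => x e he; exists e; split. Qed.

Lemma scont_sum {d : nat} (s : seq 'I_d) (G : 'I_d -> ('I_d -> R) -> R) :
  (forall i, scont (G i)) -> scont (fun x => \big[Rplus/0]_(i <- s) G i x).
Proof.
move=> hG; elim: s => [|i s ih].
  by apply: scont_ext (scont_const d 0) => x; rewrite big_nil.
by apply: scont_ext (scont_plus _ _ (hG i) ih) => x; rewrite big_cons.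
Qed.

(** * The Euclidean norm and its comparison with the sup-norm *)

Lemma scont_vnorm (d : nat) : scont (vnorm d).
Proof.
apply: (scont_comp (fun x => \big[Rplus/0]_(i < d) (x i * x i)) sqrt).
  by apply: scont_sum => i; apply: scont_mult; apply: scont_coord.
by move=> x; apply: continuous_sqrt.
Qed.

Lemma sum_sq_ge0 {d : nat} (x : 'I_d -> R) : 0 <= \big[Rplus/0]_(i < d) (x i * x i).
Proof.
by apply: (big_ind (fun a => 0 <= a)) => [|a b ha hb|i _]; [lra | lra | exact: Rle_0_sqr].
Qed.

Lemma coord_le_vnorm {d : nat} (x : 'I_d -> R) (i : 'I_d) : Rabs (x i) <= vnorm d x.
Proof.
rewrite -sqrt_Rsqr_abs; apply: sqrt_le_1_alt; rewrite /Rsqr (bigD1 i) //=.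
rewrite -[X in X <= _]Rplus_0_r; apply: Rplus_le_compat_l.
by apply: (big_ind (fun a => 0 <= a)) => [|a b ha hb|j _]; [lra | lra | exact: Rle_0_sqr].
Qed.

Lemma vnorm_le_coord {d : nat} (x : 'I_d -> R) (e : R) :
  0 <= e -> (forall i, Rabs (x i) <= e) -> vnorm d x <= (INR d + 1) * e.
Proof.
move=> he hx; have hd := pos_INR d.
rewrite -(sqrt_Rsqr ((INR d + 1) * e)); last by nra.
apply: sqrt_le_1_alt.
apply: (Rle_trans _ (\big[Rplus/0]_(i < d) (e * e))).
  apply: sum_le => i; have /Rabs_le_between := hx i; nra.
rewrite sum_const card_ord /Rsqr.
have : 0 <= e * e by nra.
by nra.
Qed.

Lemma vnorm_scale {d : nat} (l : R) (x : 'I_d -> R) :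
  0 <= l -> vnorm d (fun i => l * x i) = l * vnorm d x.
Proof.
move=> hl; rewrite /vnorm -[in RHS](sqrt_Rsqr l) // -sqrt_mult; first last.
- exact: sum_sq_ge0.
- exact: Rle_0_sqr.
congr sqrt; rewrite -sum_scal; apply: eq_bigr => i _; rewrite /Rsqr; ring.
Qed.

Lemma vnorm_ge0 {d : nat} (x : 'I_d -> R) : 0 <= vnorm d x.
Proof. exact: sqrt_pos. Qed.

Lemma cont_Rd_scont {d : nat} (F : ('I_d -> R) -> R) : cont_Rd d F -> scont F.
Proof.
move=> hF; apply/scontP => x e he; have hd := pos_INR d.
case: (hF x e he) => del [hdel h].
(* The comparison of norms costs a factor [INR d + 1]; one unit more makes the final inequality
   strict. *)
exists (del / (INR d + 2)); split; first by apply: Rdiv_lt_0_compat; lra.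
move=> y hy; apply: h.
have hq : 0 < del / (INR d + 2) by apply: Rdiv_lt_0_compat; lra.
apply: Rle_lt_trans (vnorm_le_coord _ (del / (INR d + 2)) _ _) _; first lra.
  by move=> i; have := hy i; lra.
have -> : (INR d + 1) * (del / (INR d + 2)) = del - del / (INR d + 2).
  by field; lra.
lra.
Qed.

(** Truncation of [u] to the interval from 0 to 1, written with absolute values so that continuity
    is immediate. *)
Definition clip (u : R) : R := (1 + Rabs u - Rabs (1 - u)) / 2.

Lemma clip_bounds (u : R) : 0 <= clip u <= 1.
Proof. by rewrite /clip; split_Rabs; lra. Qed.

Lemma clip_ge1 (u : R) : 1 <= u -> clip u = 1.
Proof. by rewrite /clip => hu; split_Rabs; lra. Qed.

Lemma clip_le0 (u : R) : u <= 0 -> clip u = 0.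
Proof. by rewrite /clip => hu; split_Rabs; lra. Qed.

Lemma continuous_clip (u : R) : continuous clip u.
Proof.
apply: (@continuous_mult _ R_AbsRing); last exact: continuous_const.
apply: continuous_minus.
  by apply: continuous_plus; [exact: continuous_const | exact: continuous_Rabs].
apply: continuous_Rabs_comp.
by apply: continuous_minus; [exact: continuous_const | exact: continuous_id].
Qed.

Definition cutoff {d : nat} (a b : R) (x : 'I_d -> R) : R :=
  clip ((b - vnorm d x) / (b - a)).

Lemma cutoff_bounds {d : nat} (a b : R) (x : 'I_d -> R) : 0 <= cutoff a b x <= 1.
Proof. exact: clip_bounds. Qed.

Lemma cutoff_in {d : nat} (a b : R) (x : 'I_d -> R) :
  a < b -> vnorm d x <= a -> cutoff a b x = 1.
Proof. by move=> hab hx; apply: clip_ge1; apply/Rle_div_r; lra. Qed.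

Lemma cutoff_out {d : nat} (a b : R) (x : 'I_d -> R) :
  a < b -> b <= vnorm d x -> cutoff a b x = 0.
Proof. by move=> hab hx; apply: clip_le0; apply/Rle_div_l; lra. Qed.

Lemma scont_cutoff {d : nat} (a b : R) : scont (@cutoff d a b).
Proof.
apply: (scont_comp (vnorm d) (fun s => clip ((b - s) / (b - a)))).
  exact: scont_vnorm.
move=> x; apply: continuous_comp (continuous_clip _).
apply: (@continuous_mult _ R_AbsRing); last exact: continuous_const.
by apply: continuous_minus; [exact: continuous_const | exact: continuous_id].
Qed.

Lemma csupp_cutoff {d : nat} (g : ('I_d -> R) -> R) (a b : R) :
  a < b -> csupp b (fun x => g x * cutoff a b x).
Proof.
move=> hab x [i hi]; rewrite cutoff_out ?Rmult_0_r //.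
by have := coord_le_vnorm x i; lra.
Qed.

(** * Integrals over balls *)

Lemma cube_int_le {d : nat} (F G : ('I_d -> R) -> R) (r I J : R) :
  0 <= r -> (forall x, F x <= G x) ->
  cube_int d F r I -> cube_int d G r J -> I <= J.
Proof.
move=> hr h /is_lim_seq_Reals hI /is_lim_seq_Reals hJ.
by apply: (is_lim_seq_le _ _ (Rbar.Finite I) (Rbar.Finite J) _ hI hJ) => n; apply: grid_sum_le.
Qed.

Lemma cube_int_unique {d : nat} (F : ('I_d -> R) -> R) (r I J : R) :
  cube_int d F r I -> cube_int d F r J -> I = J.
Proof. exact: UL_sequence. Qed.

Lemma cube_int_zero (d : nat) (r : R) : cube_int d (fun _ => 0) r 0.
Proof.
move=> e he; exists 0%nat => n _; rewrite grid_sum_const Rmult_0_r.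
by rewrite /Rdist Rminus_diag Rabs_R0.
Qed.

Lemma cube_int_lin {d : nat} (F G : ('I_d -> R) -> R) (a b r I J : R) :
  cube_int d F r I -> cube_int d G r J ->
  cube_int d (fun x => a * F x + b * G x) r (a * I + b * J).
Proof.
move=> /is_lim_seq_Reals hI /is_lim_seq_Reals hJ; apply/is_lim_seq_Reals.
apply: (is_lim_seq_ext (fun n => a * grid_sum d F r n.+1 + b * grid_sum d G r n.+1)).
  by move=> n; rewrite grid_sum_lin.
apply: is_lim_seq_plus'.
  exact: (is_lim_seq_scal_l _ a (Rbar.Finite I) hI).
exact: (is_lim_seq_scal_l _ b (Rbar.Finite J) hJ).
Qed.

Lemma cube_int_scale {d : nat} (F : ('I_d -> R) -> R) (l r I : R) :
  0 < l -> cube_int d F (l * r) I ->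
  cube_int d (fun x => F (fun i => l * x i)) r (I / l ^ d).
Proof.
move=> hl /is_lim_seq_Reals hI; apply/is_lim_seq_Reals.
have hld := pow_lt l d hl.
apply: (is_lim_seq_ext (fun n => / l ^ d * grid_sum d F (l * r) n.+1)).
  by move=> n; rewrite grid_sum_scale; field; lra.
rewrite (_ : I / l ^ d = / l ^ d * I); last by rewrite /Rdiv Rmult_comm.
exact: (is_lim_seq_scal_l _ (/ l ^ d) (Rbar.Finite I) hI).
Qed.

(** Compact support makes cube integrals constant from some size on. This form is stronger than
    [int_Rd] and removes its outer limit. *)
Definition int_from {d : nat} (r0 : R) (F : ('I_d -> R) -> R) (I : R) : Prop :=
  forall r, r0 <= r -> cube_int d F r I.

Definition has_int {d : nat} (F : ('I_d -> R) -> R) (I : R) : Prop :=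
  exists2 r0, 0 < r0 & int_from r0 F I.

Lemma has_int_int_Rd {d : nat} (F : ('I_d -> R) -> R) (I : R) :
  has_int F I -> int_Rd d F I.
Proof.
move=> [r0 hr0 h] eps heps; exists r0 => r hr; exists I; split; first exact: h.
by rewrite Rminus_diag Rabs_R0.
Qed.

Lemma has_int_join {d : nat} (F G : ('I_d -> R) -> R) (I J : R) :
  has_int F I -> has_int G J ->
  exists r, [/\ 0 < r, int_from r F I & int_from r G J].
Proof.
move=> [r h hF] [s h' hG]; exists (Rmax r s).
have m1 := Rmax_l r s; have m2 := Rmax_r r s.
by split=> [|t ht|t ht]; [lra | apply: hF; lra | apply: hG; lra].
Qed.

Lemma has_int_le {d : nat} (F G : ('I_d -> R) -> R) (I J : R) :
  (forall x, F x <= G x) -> has_int F I -> has_int G J -> I <= J.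
Proof.
move=> h hF hG; case: (has_int_join F G I J hF hG) => r [hr hI hJ].
have hr' : 0 <= r by lra.
exact: (cube_int_le F G r I J hr' h (hI r (Rle_refl r)) (hJ r (Rle_refl r))).
Qed.

Lemma has_int_ext {d : nat} (F G : ('I_d -> R) -> R) (I : R) :
  (forall x, F x = G x) -> has_int F I -> has_int G I.
Proof. by move=> /functional_extensionality ->. Qed.

Lemma has_int_lin {d : nat} (F G : ('I_d -> R) -> R) (a b I J : R) :
  has_int F I -> has_int G J ->
  has_int (fun x => a * F x + b * G x) (a * I + b * J).
Proof.
move=> hF hG; case: (has_int_join F G I J hF hG) => r [hr hI hJ].
by exists r => // s hs; apply: cube_int_lin; [apply: hI | apply: hJ].
Qed.

Lemma int_from_scale {d : nat} (F : ('I_d -> R) -> R) (l r0 I : R) :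
  0 < l -> int_from r0 F I ->
  int_from (r0 / l) (fun x => F (fun i => l * x i)) (I / l ^ d).
Proof.
move=> hl hI r hr; apply: cube_int_scale => //; apply: hI.
by move: hr => /Rle_div_l h; have := h hl; lra.
Qed.

Lemma has_int_scale {d : nat} (F : ('I_d -> R) -> R) (l I : R) :
  0 < l -> has_int F I -> has_int (fun x => F (fun i => l * x i)) (I / l ^ d).
Proof.
move=> hl [r0 hr0 hI]; exists (r0 / l); first exact: Rdiv_lt_0_compat.
exact: int_from_scale.
Qed.

(** The value is the supremum of the integrals of minorants. Since these integrals do not depend on
    the cube beyond [r0], neither does the supremum. *)
Lemma int_from_sandwich {d : nat} (F : ('I_d -> R) -> R) (r0 : R) :
  0 <= r0 ->
  (forall e, 0 < e -> exists g1 g2 I1 I2,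
     [/\ forall x, g1 x <= F x <= g2 x, int_from r0 g1 I1, int_from r0 g2 I2 &
         I2 - I1 <= e]) ->
  exists I, int_from r0 F I.
Proof.
move=> hr0 h.
pose E v := exists g, (forall x, g x <= F x) /\ int_from r0 g v.
have hub g I1 v : (forall x, F x <= g x) -> int_from r0 g I1 -> E v -> v <= I1.
  move=> hg hI [g' [hg' hv]]; apply: (cube_int_le g' g r0) => //.
  - by move=> x; apply: Rle_trans (hg' x) (hg x).
  - by apply: hv; lra.
  - by apply: hI; lra.
case: (h 1 Rlt_0_1) => g1 [g2 [I1 [I2 [hg h1 h2 _]]]].
have hb : bound E by exists I2 => v; apply: (hub g2) => // x; case: (hg x).
have hne : exists v, E v by exists I1, g1; split=> // x; case: (hg x).
case: (completeness E hb hne) => I [hI1 hI2]; exists I => r hr e he.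
have he2 : 0 < e / 2 by lra.
case: (h _ he2) => k1 [k2 [J1 [J2 [hk hJ1 hJ2 hJ]]]].
have b1 : J1 <= I by apply: hI1; exists k1; split=> // x; case: (hk x).
have b2 : I <= J2 by apply: hI2 => v; apply: (hub k2) => // x; case: (hk x).
case: (hJ1 r hr _ he2) => N1 c1; case: (hJ2 r hr _ he2) => N2 c2.
exists (max N1 N2) => n hn.
have /Rabs_lt_between d1 : Rabs (grid_sum d k1 r n.+1 - J1) < e / 2.
  by apply: c1; lia.
have /Rabs_lt_between d2 : Rabs (grid_sum d k2 r n.+1 - J2) < e / 2.
  by apply: c2; lia.
have l1 : grid_sum d k1 r n.+1 <= grid_sum d F r n.+1.
  by apply: grid_sum_le => [|x _]; [lra | case: (hk x)].
have l2 : grid_sum d F r n.+1 <= grid_sum d k2 r n.+1.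
  by apply: grid_sum_le => [|x _]; [lra | case: (hk x)].
by rewrite /Rdist; apply/Rabs_lt_between; lra.
Qed.

Lemma cutoff_int {d : nat} (g : ('I_d -> R) -> R) (a b : R) :
  a < b -> 0 < b -> scont g -> exists I, int_from b (fun x => g x * cutoff a b x) I.
Proof.
move=> hab hb hg.
have hs := csupp_cutoff g a b hab.
apply: (ucont_csupp_int _ b) => //; apply: (scont_csupp_ucont _ b) => //.
by apply: scont_mult => //; apply: scont_cutoff.
Qed.

Lemma cutoff_scale {d : nat} (a b l : R) (x : 'I_d -> R) :
  0 < l -> a < b -> cutoff a b (fun i => l * x i) = cutoff (a / l) (b / l) x.
Proof.
move=> hl hab; rewrite /cutoff vnorm_scale; last lra.
by congr clip; field; lra.
Qed.

Lemma ball_ind_in {d : nat} (t : R) (x : 'I_d -> R) :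
  vnorm d x <= t -> ball_ind d t x = 1.
Proof. by rewrite /ball_ind; case: Rle_dec. Qed.

Lemma ball_ind_out {d : nat} (t : R) (x : 'I_d -> R) :
  t < vnorm d x -> ball_ind d t x = 0.
Proof. by rewrite /ball_ind; case: Rle_dec => h1 h2 /=; lra. Qed.

Lemma ball_ind_bounds {d : nat} (t : R) (x : 'I_d -> R) : 0 <= ball_ind d t x <= 1.
Proof. by rewrite /ball_ind; case: Rle_dec => ? /=; lra. Qed.

Lemma ball_ind_scale {d : nat} (t l : R) (x : 'I_d -> R) :
  0 < l -> ball_ind d t (fun i => l * x i) = ball_ind d (t / l) x.
Proof.
move=> hl; rewrite /ball_ind vnorm_scale; last lra.
case: Rle_dec => h1; case: Rle_dec => h2 //.
- by case: h2; apply/Rle_div_r => //; rewrite Rmult_comm.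
- by case: h1; move/Rle_div_r: h2 => h; rewrite Rmult_comm; apply: h.
Qed.

Lemma ball_ind_mono {d : nat} (s t : R) (x : 'I_d -> R) :
  s <= t -> ball_ind d s x <= ball_ind d t x.
Proof.
move=> hst; case: (Rle_lt_dec (vnorm d x) s) => hs.
  by rewrite !ball_ind_in; lra.
by rewrite ball_ind_out //; case: (ball_ind_bounds t x).
Qed.

Lemma locally_bounded {d : nat} (g : ('I_d -> R) -> R) (t : R) :
  0 < t -> scont g -> exists2 G, 0 <= G & forall x, vnorm d x <= t -> Rabs (g x) <= G.
Proof.
move=> ht hg; have ht2 : t < 2 * t by lra.
have hs := csupp_cutoff g _ _ ht2.
have hc : scont (fun x => g x * cutoff t (2 * t) x).
  by apply: scont_mult => //; apply: scont_cutoff.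
have hu := scont_csupp_ucont _ _ hc hs.
have h0 : 0 < 2 * t by lra.
case: (ucont_csupp_bounded _ _ h0 hu hs) => G [hG0 hG].
exists G => // x hx; have := hG x; rewrite cutoff_in // Rmult_1_r.
by [].
Qed.

(* The gap between the outer and inner cutoffs is estimated by noting that one
   is a dilate of the other. *)
Lemma ball_int_pos {d : nat} (g : ('I_d -> R) -> R) (t : R) :
  0 < t -> scont g -> (forall x, 0 <= g x) ->
  exists I, int_from (3 * t) (fun x => g x * ball_ind d t x) I.
Proof.
move=> ht hg g0; apply: int_from_sandwich => [|e he]; first lra.
have ht2 : 0 < 2 * t by lra.
case: (locally_bounded g _ ht2 hg) => G hG0 hG.
have h23 : 2 * t < 3 * t by lra.
have h3 : 0 < 3 * t by lra.
(* [C] bounds the integral [A] of every outer cutoff used below, independently of how thin the gap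
   is. *)
case: (cutoff_int (fun _ => 1) _ _ h23 h3 (scont_const d 1)) => C hC.
have hd := pos_INR d.
have weaken b F I : b <= 3 * t -> @int_from d b F I -> int_from (3 * t) F I.
  by move=> hb h r hr; apply: h; lra.
have hC0 : 0 <= C.
  have z := cube_int_zero d (3 * t).
  apply: (cube_int_le _ _ (3 * t) _ _ _ _ z (hC (3 * t) (Rle_refl _))); first lra.
  by move=> x; rewrite Rmult_1_l; case: (cutoff_bounds (2 * t) (3 * t) x).
have hD : 0 <= INR d * G * C by apply: Rmult_le_pos => //; nra.
(* The bound 1/2 keeps the outer radius [t / m] below [2 * t]; the other bound makes the final gap
   [INR d * G * C * y] at most [e]. *)
pose y := Rmin (/ 2) (e / (1 + INR d * G * C)).
have y1 : y <= / 2 := Rmin_l _ _.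
have y2 : y <= e / (1 + INR d * G * C) := Rmin_r _ _.
have y0 : 0 < y.
  by apply: Rmin_glb_lt; [lra | apply: Rdiv_lt_0_compat; lra].
have y3 : y * (INR d * G * C) <= e.
  by move/Rle_div_r: y2 => h; have := h ltac:(lra); nra.
pose m := 1 - y.
have hm : 0 < m by rewrite /m; lra.
have hm1 : m < 1 by rewrite /m; lra.
have ht1 : m * t < t by nra.
have ht4 : t < t / m by apply/Rlt_div_r => //; nra.
have ht5 : t / m <= 2 * t by apply/Rle_div_l => //; rewrite /m; nra.
have htm : 0 < t / m by lra.
case: (cutoff_int g _ _ ht1 ht hg) => I1 hI1.
case: (cutoff_int g _ _ ht4 htm hg) => I2 hI2.
case: (cutoff_int (fun _ => 1) _ _ ht4 htm (scont_const d 1)) => A hA.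
(* The inner cutoff is the outer one dilated by [m], so its integral is exactly [m ^ d * A]. *)
have hA' : int_from t (fun x : 'I_d -> R => 1 * cutoff (m * t) t x) (m ^ d * A).
  have hm' : 0 < / m by apply: Rinv_0_lt_compat.
  have := int_from_scale _ (/ m) _ _ hm' hA.
  have -> : t / m / / m = t by field; lra.
  rewrite (_ : A / (/ m) ^ d = m ^ d * A); last first.
    by rewrite pow_inv; field; apply: pow_nonzero; lra.
  rewrite (_ : (fun x : 'I_d -> R => 1 * cutoff t (t / m) (fun i => / m * x i))
     = (fun x => 1 * cutoff (m * t) t x)) //.
  apply: functional_extensionality => x; rewrite cutoff_scale //.
  by congr (_ * cutoff _ _ _); field; lra.
exists (fun x => g x * cutoff (m * t) t x), (fun x => g x * cutoff t (t / m) x), I1, I2.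
split; [ | by apply: weaken hI1; lra | by apply: weaken hI2; lra | ].
  move=> x; have h0 := g0 x.
  have [c1 c2] := cutoff_bounds (m * t) t x; have [c3 c4] := cutoff_bounds t (t / m) x.
  case: (Rle_lt_dec (vnorm d x) t) => hx.
    by rewrite (ball_ind_in t) // (cutoff_in t (t / m)) //; nra.
  by rewrite (ball_ind_out t) // (cutoff_out (m * t) t) //; [nra | lra].
have hAC : A <= C.
  apply: (cube_int_le _ _ (3 * t) _ _ _ _ (hA (3 * t) _) (hC (3 * t) _)); try lra.
  move=> x; rewrite !Rmult_1_l.
  have [c1 c2] := cutoff_bounds t (t / m) x.
  have [c3 c4] := cutoff_bounds (2 * t) (3 * t) x.
  case: (Rle_lt_dec (vnorm d x) (2 * t)) => hx.
    by rewrite (cutoff_in (2 * t)) //; lra.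
  by rewrite (cutoff_out t (t / m)) //; lra.
have hmd := pow_ge_linear m d (conj (Rlt_le _ _ hm) (Rlt_le _ _ hm1)).
(* [g] is at most [G] wherever the two cutoffs differ. *)
have hgap : I2 - I1 <= G * A - G * (m ^ d * A).
  have e1 := cube_int_lin _ _ 1 (-1) _ _ _ (hI2 (3 * t) ltac:(lra)) (hI1 (3 * t) ltac:(lra)).
  have e2 := cube_int_lin _ _ G (- G) _ _ _ (hA (3 * t) ltac:(lra)) (hA' (3 * t) ltac:(lra)).
  suff : 1 * I2 + -1 * I1 <= G * A + - G * (m ^ d * A) by lra.
  apply: (cube_int_le _ _ (3 * t) _ _ _ _ e1 e2); first lra.
  move=> x.
  suff : g x * (cutoff t (t / m) x - cutoff (m * t) t x)
     <= G * (cutoff t (t / m) x - cutoff (m * t) t x) by lra.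
  case: (Rle_lt_dec (vnorm d x) (2 * t)) => hx.
    have := hG x hx; rewrite Rabs_pos_eq // => hgx.
    apply: Rmult_le_compat_r => //.
    have [c1 c2] := cutoff_bounds (m * t) t x; have [c3 c4] := cutoff_bounds t (t / m) x.
    case: (Rle_lt_dec (vnorm d x) t) => hx'.
      by rewrite (cutoff_in t (t / m)) //; lra.
    by rewrite (cutoff_out (m * t) t) //; lra.
  by rewrite !cutoff_out; lra.
have e1 : 1 - m = y by rewrite /m; ring.
have q1 : 1 - m ^ d <= INR d * y by rewrite e1 in hmd; lra.
have hA0 : 0 <= A.
  have z := cube_int_zero d (3 * t).
  apply: (cube_int_le _ _ (3 * t) _ _ _ _ z (hA (3 * t) _)); try lra.
  by move=> x; rewrite Rmult_1_l; case: (cutoff_bounds t (t / m) x).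
have q2 : G * A * (1 - m ^ d) <= G * C * (INR d * y).
  apply: Rmult_le_compat => //; [nra | lra | nra].
lra.
Qed.

Lemma has_int_zero (d : nat) : has_int (fun _ : 'I_d -> R => 0) 0.
Proof.
by exists 1 => [|r hr]; [lra | exact: cube_int_zero].
Qed.

Lemma has_int_unique {d : nat} (F : ('I_d -> R) -> R) (I J : R) :
  has_int F I -> has_int F J -> I = J.
Proof.
move=> hI hJ; case: (has_int_join _ _ _ _ hI hJ) => r [hr h h'].
exact: cube_int_unique (h r (Rle_refl r)) (h' r (Rle_refl r)).
Qed.

Lemma pow_le_self (y : R) (d : nat) : (0 < d)%nat -> 0 <= y <= 1 -> y ^ d <= y.
Proof.
case: d => // d _ hy; rewrite -tech_pow_Rmult.
have := pow_ge_linear y d hy; have : 0 <= y ^ d by apply: pow_le; lra.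
nra.
Qed.

(** The origin lies in balls of radius [y] and volume at most [y * V]. This is where [d] must be
    positive: in dimension 0 the point carries full mass. *)
Lemma ball_int_zero {d : nat} (g : ('I_d -> R) -> R) :
  (0 < d)%nat -> scont g -> (forall x, 0 <= g x) ->
  has_int (fun x => g x * ball_ind d 0 x) 0.
Proof.
move=> hd hg g0.
case: (locally_bounded g 1 Rlt_0_1 hg) => G hG0 hG.
case: (ball_int_pos (fun _ => 1) 1 Rlt_0_1 (scont_const d 1) (fun _ => Rle_0_1)) => V hV.
have hV' : has_int (fun x => 1 * ball_ind d 1 x) V by exists (3 * 1) => //; lra.
have hV0 : 0 <= V.
  apply: has_int_le (has_int_zero d) hV' => x.
  by case: (ball_ind_bounds 1 x); lra.
have h0 : int_from 3 (fun _ : 'I_d -> R => 0) 0.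
  by move=> r hr; exact: cube_int_zero.
have up e : 0 < e -> exists g2 I2, [/\ forall x, g x * ball_ind d 0 x <= g2 x,
    int_from 3 g2 I2 & I2 <= e].
  move=> he; have hGV : 0 <= G * V by nra.
  pose y := Rmin 1 (e / (1 + G * V)).
  have y1 : y <= 1 := Rmin_l _ _.
  have y2 : y <= e / (1 + G * V) := Rmin_r _ _.
  have y0 : 0 < y by apply: Rmin_glb_lt; [lra | apply: Rdiv_lt_0_compat; lra].
  have y3 : y * (G * V) <= e.
    by move/Rle_div_r: y2 => h; have := h ltac:(lra); nra.
  have yi : 0 < / y by apply: Rinv_0_lt_compat.
  have hb := int_from_scale _ (/ y) _ _ yi hV.
  have yd : 0 < y ^ d by apply: pow_lt.
  have eV : V / (/ y) ^ d = y ^ d * V.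
    by rewrite pow_inv; field; apply: pow_nonzero; lra.
  have hz : int_from 3 (fun x : 'I_d -> R =>
      G * (1 * ball_ind d 1 (fun i => / y * x i)) + 0 * 0)
      (G * (y ^ d * V) + 0 * 0).
    move=> r hr; apply: cube_int_lin; last exact: h0.
    rewrite -eV; apply: hb; apply: Rle_trans hr.
    by rewrite /Rdiv Rinv_inv; lra.
  exists (fun x : 'I_d -> R => G * (1 * ball_ind d 1 (fun i => / y * x i)) + 0 * 0).
  exists (G * (y ^ d * V) + 0 * 0).
  split=> //; last first.
    have hyd := pow_le_self y d hd (conj (Rlt_le _ _ y0) y1).
    have : y ^ d * (G * V) <= y * (G * V) by apply: Rmult_le_compat_r.
    lra.
  move=> x; rewrite ball_ind_scale // (_ : 1 / / y = y); last by field; lra.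
  case: (Rle_lt_dec (vnorm d x) 0) => hx.
    rewrite !ball_ind_in; try lra.
    have : vnorm d x <= 1 by lra.
    by move=> /hG; rewrite Rabs_pos_eq //; lra.
  by rewrite ball_ind_out //; case: (ball_ind_bounds y x); nra.
have h3 : 0 <= 3 by lra.
have [I hI] : exists I, int_from 3 (fun x => g x * ball_ind d 0 x) I.
  apply: int_from_sandwich h3 _ => e he.
  case: (up e he) => g2 [I2 [h1 h2 hI2]].
  exists (fun _ => 0), g2, 0, I2; split=> //; last lra.
  move=> x; split=> //; have := g0 x; case: (ball_ind_bounds 0 x); nra.
have I0 : 0 <= I.
  apply: (cube_int_le _ _ 3 _ _ h3 _ (h0 3 (Rle_refl 3)) (hI 3 (Rle_refl 3))) => x.
  by have := g0 x; case: (ball_ind_bounds 0 x); nra.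
suff e : I = 0.
  by exists 3; [lra | move: hI; rewrite e].
apply: Rle_antisym => //; apply: le_epsilon => e he.
case: (up e he) => g2 [I2 [h1 h2 hI2]].
have := cube_int_le _ _ 3 _ _ h3 h1 (hI 3 (Rle_refl 3)) (h2 3 (Rle_refl 3)); lra.
Qed.

Lemma ball_int {d : nat} (g : ('I_d -> R) -> R) (t : R) :
  (0 < d)%nat -> 0 <= t -> scont g -> (forall x, 0 <= g x) ->
  exists I, has_int (fun x => g x * ball_ind d t x) I.
Proof.
move=> hd [ht|<-] hg g0; last by exists 0; apply: ball_int_zero.
by case: (ball_int_pos g t ht hg g0) => I hI; exists I, (3 * t) => //; lra.
Qed.

(** Choosing a value by [epsilon] makes ball integrals a function of the radius, which can then be
    evaluated along a sequence of nodes. *)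
Definition integral {d : nat} (F : ('I_d -> R) -> R) : R :=
  epsilon (inhabits 0) (has_int F).

Lemma integralP {d : nat} (F : ('I_d -> R) -> R) :
  (exists I, has_int F I) -> has_int F (integral F).
Proof. exact: epsilon_spec. Qed.

Definition ball_integral {d : nat} (g : ('I_d -> R) -> R) (t : R) : R :=
  integral (fun x => g x * ball_ind d t x).

Lemma ball_integralP {d : nat} (g : ('I_d -> R) -> R) (t : R) :
  (0 < d)%nat -> 0 <= t -> scont g -> (forall x, 0 <= g x) ->
  has_int (fun x => g x * ball_ind d t x) (ball_integral g t).
Proof. by move=> hd ht hg g0; apply: integralP; apply: ball_int. Qed.

Lemma ball_integral_ge0 {d : nat} (g : ('I_d -> R) -> R) (t : R) :
  (0 < d)%nat -> 0 <= t -> scont g -> (forall x, 0 <= g x) ->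
  0 <= ball_integral g t.
Proof.
move=> hd ht hg g0; apply: has_int_le (has_int_zero d) (ball_integralP g t _ _ _ _) => //.
by move=> x; have := g0 x; case: (ball_ind_bounds t x); nra.
Qed.

Lemma shell_int {d : nat} (g : ('I_d -> R) -> R) (a b : R) :
  (0 < d)%nat -> 0 <= a -> 0 <= b -> scont g -> (forall x, 0 <= g x) ->
  has_int (fun x => g x * (ball_ind d b x - ball_ind d a x))
    (ball_integral g b - ball_integral g a).
Proof.
move=> hd ha hb hg g0.
have h := has_int_lin _ _ 1 (-1) _ _ (ball_integralP g b hd hb hg g0)
  (ball_integralP g a hd ha hg g0).
rewrite (_ : ball_integral g b - ball_integral g a
  = 1 * ball_integral g b + -1 * ball_integral g a); last ring.
by apply: has_int_ext h => x; ring.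
Qed.

Lemma ball_integral_mono {d : nat} (g : ('I_d -> R) -> R) (a b : R) :
  (0 < d)%nat -> 0 <= a <= b -> scont g -> (forall x, 0 <= g x) ->
  ball_integral g a <= ball_integral g b.
Proof.
move=> hd [ha hab] hg g0; have hb : 0 <= b by lra.
apply: has_int_le (ball_integralP g a hd ha hg g0) (ball_integralP g b hd hb hg g0).
by move=> x; have := ball_ind_mono a b x hab; have := g0 x; nra.
Qed.

(** * Nearly constant weights and dilations on balls and shells *)

Lemma approx_int {d : nat} (h w : ('I_d -> R) -> R) (c e X Y : R) :
  (forall x, 0 <= h x) -> (forall x, h x <> 0 -> Rabs (w x - c) <= e) ->
  has_int h X -> has_int (fun x => h x * w x) Y -> Rabs (Y - c * X) <= e * X.
Proof.
move=> h0 hw hX hY; apply: Rabs_le.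
(* Scaling is obtained from [has_int_lin] with the zero function, hence the summand [0 * 0]. *)
have l1 := has_int_lin _ _ (c - e) 0 _ _ hX (has_int_zero d).
have l2 := has_int_lin _ _ (c + e) 0 _ _ hX (has_int_zero d).
have key x : (c - e) * h x + 0 * 0 <= h x * w x <= (c + e) * h x + 0 * 0.
  case: (Req_dec (h x) 0) => [->|hx]; first lra.
  have /Rabs_le_between := hw x hx; have := h0 x; nra.
have := has_int_le _ _ _ _ (fun x => proj1 (key x)) l1 hY.
have := has_int_le _ _ _ _ (fun x => proj2 (key x)) hY l2.
lra.
Qed.

Lemma shell_approx {d : nat} (g : ('I_d -> R) -> R) (rho : R -> R) (a b c e : R) :
  (0 < d)%nat -> 0 <= a <= b -> scont g -> (forall x, 0 <= g x) ->
  scont (fun x => g x * rho (vnorm d x)) ->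
  (forall x, 0 <= g x * rho (vnorm d x)) ->
  (forall u, a < u <= b -> Rabs (rho u - c) <= e) ->
  Rabs (ball_integral (fun x => g x * rho (vnorm d x)) b
        - ball_integral (fun x => g x * rho (vnorm d x)) a
        - c * (ball_integral g b - ball_integral g a))
  <= e * (ball_integral g b - ball_integral g a).
Proof.
move=> hd [ha hab] hg g0 hgr gr0 hc; have hb : 0 <= b by lra.
have hX := shell_int g a b hd ha hb hg g0.
have hY := shell_int _ a b hd ha hb hgr gr0.
apply: (approx_int _ (fun x => rho (vnorm d x)) c e _ _ _ _ hX).
- by move=> x; have := ball_ind_mono a b x hab; have := g0 x; nra.
- move=> x hx; apply: hc; split.
    apply: Rnot_le_lt => h; apply: hx.
    by rewrite !ball_ind_in; [ring | lra | lra].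
  apply: Rnot_lt_le => h; apply: hx.
  by rewrite !ball_ind_out; [ring | lra | lra].
- by apply: has_int_ext hY => x; ring.
Qed.

Lemma ball_approx {d : nat} (g : ('I_d -> R) -> R) (rho : R -> R) (b c e : R) :
  (0 < d)%nat -> 0 <= b -> scont g -> (forall x, 0 <= g x) ->
  scont (fun x => g x * rho (vnorm d x)) ->
  (forall x, 0 <= g x * rho (vnorm d x)) ->
  (forall u, 0 <= u <= b -> Rabs (rho u - c) <= e) ->
  Rabs (ball_integral (fun x => g x * rho (vnorm d x)) b - c * ball_integral g b)
  <= e * ball_integral g b.
Proof.
move=> hd hb hg g0 hgr gr0 hc.
have hX := ball_integralP g b hd hb hg g0.
have hY := ball_integralP _ b hd hb hgr gr0.
apply: (approx_int _ (fun x => rho (vnorm d x)) c e _ _ _ _ hX).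
- by move=> x; case: (ball_ind_bounds b x); have := g0 x; nra.
- move=> x hx; apply: hc; split; first exact: vnorm_ge0.
  apply: Rnot_lt_le => h; apply: hx.
  by rewrite ball_ind_out; [ring | lra].
- by apply: has_int_ext hY => x; ring.
Qed.

Lemma shell_dilate {d : nat} (f : ('I_d -> R) -> R) (q a b : R) :
  (0 < d)%nat -> 1 <= q -> 0 <= a <= b -> scont f -> (forall x, 0 <= f x) ->
  (forall x, f (fun i => q * x i) <= f x) ->
  ball_integral f (q * b) - ball_integral f (q * a)
  <= q ^ d * (ball_integral f b - ball_integral f a).
Proof.
move=> hd hq [ha hab] hf f0 hdec; have hb : 0 <= b by lra.
have hq0 : 0 < q by lra.
have hqd : 0 < q ^ d by apply: pow_lt.
have hqa : 0 <= q * a by nra.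
have hqb : 0 <= q * b by nra.
have h1 := has_int_scale _ q _ hq0 (shell_int f _ _ hd hqa hqb hf f0).
have h2 := shell_int f a b hd ha hb hf f0.
have : (ball_integral f (q * b) - ball_integral f (q * a)) / q ^ d
   <= ball_integral f b - ball_integral f a.
  apply: has_int_le h1 h2 => x; rewrite !ball_ind_scale //.
  rewrite (_ : q * b / q = b); last by field; lra.
  rewrite (_ : q * a / q = a); last by field; lra.
  apply: Rmult_le_compat_r => //.
  by have := ball_ind_mono a b x hab; lra.
by move/Rle_div_l => h; have := h hqd; lra.
Qed.

Lemma ball_dilate {d : nat} (f : ('I_d -> R) -> R) (q b : R) :
  (0 < d)%nat -> 1 <= q -> 0 <= b -> scont f -> (forall x, 0 <= f x) ->
  (forall x, f (fun i => q * x i) <= f x) ->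
  ball_integral f (q * b) <= q ^ d * ball_integral f b.
Proof.
move=> hd hq hb hf f0 hdec.
have hq0 : 0 < q by lra.
have hqd : 0 < q ^ d by apply: pow_lt.
have hqb : 0 <= q * b by nra.
have h1 := has_int_scale _ q _ hq0 (ball_integralP f _ hd hqb hf f0).
have h2 := ball_integralP f b hd hb hf f0.
have : ball_integral f (q * b) / q ^ d <= ball_integral f b.
  apply: has_int_le h1 h2 => x; rewrite ball_ind_scale //.
  rewrite (_ : q * b / q = b); last by field; lra.
  by apply: Rmult_le_compat_r => //; case: (ball_ind_bounds b x).
by move/Rle_div_l => h; have := h hqd; lra.
Qed.

Lemma ball_volume_scale (d : nat) (q b : R) :
  (0 < d)%nat -> 0 < q -> 0 <= b ->
  ball_integral (fun _ : 'I_d -> R => 1) (q * b)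
  = q ^ d * ball_integral (fun _ : 'I_d -> R => 1) b.
Proof.
move=> hd hq0 hb.
have hqd : 0 < q ^ d by apply: pow_lt.
have hqb : 0 <= q * b by nra.
have c1 := scont_const d 1; have p1 : forall x : 'I_d -> R, 0 <= 1 by move=> _; lra.
have h1 := has_int_scale _ q _ hq0 (ball_integralP (fun _ => 1) _ hd hqb c1 p1).
have h2 := ball_integralP (fun _ => 1) b hd hb c1 p1.
have e : ball_integral (fun _ : 'I_d -> R => 1) (q * b) / q ^ d
   = ball_integral (fun _ : 'I_d -> R => 1) b.
  apply: has_int_unique h2; apply: has_int_ext h1 => x.
  by rewrite ball_ind_scale // (_ : q * b / q = b) //; field; lra.
by rewrite -e; field; lra.
Qed.

(** * Correlation of radial weights *)

(** The increments of [Q] grow by exactly [D] and those of [P] by at most [D], so their quotients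
    decrease; [be] is the quotient at index [K]. *)
Lemma geometric_threshold (P Q : nat -> R) (D b : R) (K : nat) :
  1 < D -> 0 <= b -> 0 <= P 0%nat -> 0 <= Q 0%nat ->
  (forall i, P i <= P i.+1) -> (forall i, Q i.+1 = D * Q i) ->
  P 1%nat <= D * P 0%nat ->
  (forall i, P i.+2 - P i.+1 <= D * (P i.+1 - P i)) ->
  (forall i, P i.+1 - P i <= b * (Q i.+1 - Q i)) ->
  exists be, [/\ 0 <= be <= b, be * Q 0%nat <= P 0%nat,
    forall i, (i <= K)%nat -> be * (Q i.+1 - Q i) <= P i.+1 - P i &
    forall i, (K <= i)%nat -> P i.+1 - P i <= be * (Q i.+1 - Q i)].
Proof.
move=> hD hb P0 Q0 Pm QD PD0 PD Pb.
have eQ i : Q i = D ^ i * Q 0%nat.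
  by elim: i => [|i ih]; [rewrite /=; ring | rewrite QD ih /=; ring].
have eW i : Q i.+1 - Q i = D ^ i * ((D - 1) * Q 0%nat).
  by rewrite (eQ i.+1) (eQ i) /=; ring.
have Dp i : 0 < D ^ i by apply: pow_lt; lra.
(* If [Q 0] vanishes, then so do all increments of [Q], and the bound by [b] forces those of [P] to
   vanish. *)
case: (Rle_lt_or_eq_dec _ _ Q0) => [Qp|Qz]; last first.
  have z i : Q i.+1 - Q i = 0 by rewrite eW -Qz; ring.
  exists 0; split; [lra | rewrite -Qz; lra | |].
  - by move=> i _; rewrite z; have := Pm i; lra.
  - by move=> i _; have := Pb i; rewrite z; lra.
have cross i n : P (i + n).+1 - P (i + n)%nat <= D ^ n * (P i.+1 - P i).
  elim: n => [|n ih]; first by rewrite addn0 /=; lra.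
  by rewrite addnS -tech_pow_Rmult; have := PD (i + n)%nat; nra.
have Wp i : 0 < Q i.+1 - Q i.
  by rewrite eW; apply: Rmult_lt_0_compat => //; apply: Rmult_lt_0_compat; lra.
pose be := (P K.+1 - P K) / (Q K.+1 - Q K).
have ebe : P K.+1 - P K = be * (Q K.+1 - Q K).
  by rewrite /be; field; have := Wp K; lra.
have be0 : 0 <= be by apply: Rdiv_le_0_compat; [have := Pm K; lra | exact: Wp].
have low i : (i <= K)%nat -> be * (Q i.+1 - Q i) <= P i.+1 - P i.
  move=> hi; have := cross i (K - i)%nat; rewrite subnKC // ebe.
  have -> : Q K.+1 - Q K = D ^ (K - i) * (Q i.+1 - Q i).
    rewrite !eW -[in D ^ K](subnKC hi) addnC.
    by rewrite -plusE pow_add; ring.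
  by have := Dp (K - i)%nat; nra.
exists be; split=> //.
- by split=> //; apply/Rle_div_l; [exact: Wp | exact: Pb].
(* The first increments are at most [(D - 1) * P 0] and exactly [(D - 1) * Q 0], so the initial ball
   has at least the quotient of the first shell. *)
- have := low 0%nat (leq0n K); rewrite QD; nra.
- move=> i hi; have := cross K (i - K)%nat; rewrite subnKC // ebe.
  have -> : Q i.+1 - Q i = D ^ (i - K) * (Q K.+1 - Q K).
    rewrite !eW -[in D ^ i](subnKC hi) addnC.
    by rewrite -plusE pow_add; ring.
  by have := Dp (i - K)%nat; nra.
Qed.

(* A discrete Chebyshev inequality. [P], [Q] are the unweighted masses of nested
   balls, [A], [M] the masses weighted by a function that is within [e] of [c]
   on the first ball and of [w i] on the i-th shell. *)
Lemma weighted_chebyshev (P Q A M w : nat -> R) (c D b e : R) (K N : nat) :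
  1 < D -> 0 <= b -> 0 <= e -> 0 <= c -> (forall i, 0 <= w i) ->
  0 <= P 0%nat -> 0 <= Q 0%nat -> 0 <= M 0%nat ->
  (forall i, P i <= P i.+1) -> (forall i, Q i.+1 = D * Q i) ->
  (forall i, M i <= M i.+1) ->
  P 1%nat <= D * P 0%nat ->
  (forall i, P i.+2 - P i.+1 <= D * (P i.+1 - P i)) ->
  (forall i, P i.+1 - P i <= b * (Q i.+1 - Q i)) ->
  Rabs (A 0%nat - c * P 0%nat) <= e * P 0%nat ->
  Rabs (M 0%nat - c * Q 0%nat) <= e * Q 0%nat ->
  (forall i, (i < K + N)%nat ->
    Rabs (A i.+1 - A i - w i * (P i.+1 - P i)) <= e * (P i.+1 - P i)) ->
  (forall i, (i < K + N)%nat ->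
    Rabs (M i.+1 - M i - w i * (Q i.+1 - Q i)) <= e * (Q i.+1 - Q i)) ->
  A (K + N)%nat * M K <= A K * M (K + N)%nat
    + e * ((P (K + N)%nat + b * Q (K + N)%nat) * M (K + N)%nat).
Proof.
move=> hD hb he hc hw P0 Q0 M0 Pm QD Mm PD0 PD Pb A0 N0 Ai Mi.
case: (geometric_threshold P Q D b K hD hb P0 Q0 Pm QD PD0 PD Pb)
  => be [[be0 beb] beP lo hi].
(* The increments telescope; each replacement of a weighted increment by [w i] times the unweighted
   one costs [e] times the latter. *)
have inner i : (i <= K)%nat -> be * M i - e * (P i + be * Q i) <= A i.
  elim: i => [_|i ih hiK].
    move/Rabs_le_between: A0 => A0; move/Rabs_le_between: N0 => N0.
    have : be * (M 0%nat - c * Q 0%nat) <= be * (e * Q 0%nat).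
      by apply: Rmult_le_compat_l => //; lra.
    have : c * (be * Q 0%nat) <= c * P 0%nat by apply: Rmult_le_compat_l.
    lra.
  have hiN : (i < K + N)%nat by apply: leq_trans hiK (leq_addr _ _).
  have /Rabs_le_between a1 := Ai i hiN; have /Rabs_le_between a2 := Mi i hiN.
  have : be * (M i.+1 - M i - w i * (Q i.+1 - Q i)) <= be * (e * (Q i.+1 - Q i)).
    by apply: Rmult_le_compat_l => //; lra.
  have : w i * (be * (Q i.+1 - Q i)) <= w i * (P i.+1 - P i).
    by apply: Rmult_le_compat_l => //; apply: lo; apply: ltnW.
  have := ih (ltnW hiK); lra.
have outer n : (n <= N)%nat -> A (K + n)%nat - A K <= be * (M (K + n)%nat - M K)
    + e * ((P (K + n)%nat - P K) + be * (Q (K + n)%nat - Q K)).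
  elim: n => [_|n ih hn]; first by rewrite addn0; lra.
  rewrite addnS; have hin : (K + n < K + N)%nat by rewrite ltn_add2l.
  set i := (K + n)%nat in ih hin *.
  have /Rabs_le_between a1 := Ai i hin; have /Rabs_le_between a2 := Mi i hin.
  have : be * - (e * (Q i.+1 - Q i)) <= be * (M i.+1 - M i - w i * (Q i.+1 - Q i)).
    by apply: Rmult_le_compat_l => //; lra.
  have : w i * (P i.+1 - P i) <= w i * (be * (Q i.+1 - Q i)).
    by apply: Rmult_le_compat_l => //; apply: hi; apply: leq_addr.
  have := ih (ltnW hn); lra.
have mono (u : nat -> R) : (forall i, u i <= u i.+1) -> forall i n, u i <= u (i + n)%nat.
  move=> hu i; elim=> [|n ih]; first by rewrite addn0; lra.
  by rewrite addnS; have := hu (i + n)%nat; lra.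
have Qm i : Q i <= Q i.+1.
  have Qi : 0 <= Q i by elim: i => // i ih; rewrite QD; nra.
  by rewrite QD; nra.
have h1 := inner K (leqnn K); have h2 := outer N (leqnn N).
have MK : M K <= M (K + N)%nat by apply: mono.
have MK0 : 0 <= M K by have := mono M Mm 0%nat K; rewrite add0n; lra.
have PK : P K <= P (K + N)%nat by apply: mono.
have PK0 : 0 <= P K by have := mono P Pm 0%nat K; rewrite add0n; lra.
have QK : Q K <= Q (K + N)%nat by apply: mono.
have QK0 : 0 <= Q K by have := mono Q Qm 0%nat K; rewrite add0n; lra.
move: h1 h2 MK PK QK.
move: (A (K + N)%nat) (M (K + N)%nat) (P (K + N)%nat) (Q (K + N)%nat) => AN MN PN QN.
move=> h1 h2 MK PK QK.
(* Up to errors, [A K] is at least [be * M K] and [AN - A K] at most [be * (MN - M K)].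
   Cross-multiplying eliminates [be], and adding [A K * M K] gives the claim. *)
have e1 : (be * M K - e * (P K + be * Q K)) * (MN - M K) <= A K * (MN - M K).
  by apply: Rmult_le_compat_r; lra.
have e2 : (AN - A K) * M K
  <= (be * (MN - M K) + e * ((PN - P K) + be * (QN - Q K))) * M K.
  by apply: Rmult_le_compat_r.
have bQ : be * QN <= b * QN by apply: Rmult_le_compat_r; lra.
have bK : be * Q K <= be * QN by apply: Rmult_le_compat_l.
have bK0 : 0 <= be * Q K by apply: Rmult_le_pos.
have e3 : (P K + be * Q K) * (MN - M K) + ((PN - P K) + be * (QN - Q K)) * M K
   <= (PN + b * QN) * MN.
  have f1 : (P K + be * Q K) * (MN - M K) <= (PN + b * QN) * (MN - M K).
    by apply: Rmult_le_compat_r; lra.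
  have f2 : ((PN - P K) + be * (QN - Q K)) * M K <= (PN + b * QN) * M K.
    by apply: Rmult_le_compat_r; lra.
  lra.
have e4 := Rmult_le_compat_l e _ _ he e3.
lra.
Qed.

(** With [q] the [N]-th root of [s / r], both radii are nodes. A large [N] makes every shell thin;
    [K] is chosen afterwards to shrink the innermost ball. *)
Lemma geometric_nodes (r s del : R) : 0 < r < s -> 0 < del ->
  exists q K N, [/\ 1 < q, (q - 1) * s < del, r / q ^ K < del &
    r / q ^ K * q ^ (K + N) = s].
Proof.
move=> [hr hrs] hdel.
(* [q <= 1 + y] will give shells of width at most [del / 2]. *)
pose y := del / (2 * s).
have hy : 0 < y by apply: Rdiv_lt_0_compat; lra.
have hP : 1 < s / r by apply/Rlt_div_r; lra.
have h1y : Rabs (1 + y) > 1 by rewrite Rabs_pos_eq; lra.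
case: (Pow_x_infinity (1 + y) h1y (s / r)) => N0 hN0.
pose N := N0.+1.
have hN : s / r <= (1 + y) ^ N.
  have := hN0 N; rewrite Rabs_pos_eq; last by apply: pow_le; lra.
  by move=> h; apply: Rge_le; apply: h; rewrite /N; lia.
have hNp : 0 < INR N by apply: lt_0_INR; rewrite /N; lia.
pose q := Rpower (s / r) (/ INR N).
have hq0 : 0 < q by apply: exp_pos.
have hqN : q ^ N = s / r.
  rewrite -Rpower_pow // /q Rpower_mult Rinv_l; last lra.
  by rewrite Rpower_1 //; lra.
have hq1 : 1 < q.
  apply: Rnot_le_lt => h.
  have : q ^ N <= 1 ^ N by apply: pow_incr; lra.
  by rewrite pow1 hqN; lra.
have hqy : q <= 1 + y.
  apply: Rnot_lt_le => h.
  have : (1 + y) ^ N < q ^ N.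
    rewrite -!tech_pow_Rmult.
    have : (1 + y) ^ N0 <= q ^ N0 by apply: pow_incr; lra.
    have : 0 < (1 + y) ^ N0 by apply: pow_lt; lra.
    nra.
  by rewrite hqN; lra.
have haq : Rabs q > 1 by rewrite Rabs_pos_eq; lra.
case: (Pow_x_infinity q haq (2 * r / del)) => K hK.
have hqK : 0 < q ^ K by apply: pow_lt.
exists q, K, N; split=> //.
- have : (q - 1) * s <= y * s by nra.
  have -> : y * s = del / 2 by rewrite /y; field; lra.
  lra.
- have := hK K (Nat.le_refl K); rewrite Rabs_pos_eq; last lra.
  move=> /Rge_le /Rle_div_l h; have := h hdel => h'.
  by apply/Rlt_div_l => //; lra.
- rewrite -plusE pow_add hqN; field; lra.
Qed.

(** The factor 1 in the masses makes them the case [g = 1] of the lemmas on balls and shells. *)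
Lemma radial_correlation {d : nat} (rho : R -> R) (f : ('I_d -> R) -> R)
    (f0 r s : R) :
  (0 < d)%nat -> (forall t, continuity_pt rho t) -> (forall t, 0 <= rho t) ->
  scont f -> (forall x, 0 <= f x <= f0) ->
  (forall q x, 1 <= q -> f (fun i => q * x i) <= f x) -> 0 < r < s ->
  ball_integral (fun x => f x * rho (vnorm d x)) s
    * ball_integral (fun x => 1 * rho (vnorm d x)) r
  <= ball_integral (fun x => f x * rho (vnorm d x)) r
    * ball_integral (fun x => 1 * rho (vnorm d x)) s.
Proof.
move=> hd rho_c rho0 hf hfb hdec [hr hrs].
have f_0 x : 0 <= f x by case: (hfb x).
have f00 : 0 <= f0 by case: (hfb (vzero d)); lra.
have hrn : scont (fun x => rho (vnorm d x)).
  apply: (scont_comp (vnorm d) rho (scont_vnorm d)) => x.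
  by apply/continuity_pt_filterlim.
have hone := scont_const d 1.
have hfr := scont_mult _ _ hf hrn; have h1r := scont_mult _ _ hone hrn.
have one0 : forall x : 'I_d -> R, 0 <= 1 by move=> _; lra.
have fr0 x : 0 <= f x * rho (vnorm d x) by apply: Rmult_le_pos.
have r0 : forall x, 0 <= 1 * rho (vnorm d x).
  by move=> x; apply: Rmult_le_pos; [lra | exact: rho0].
set A := ball_integral (fun x => f x * _); set M := ball_integral (fun x => 1 * _).
pose P := ball_integral f; pose Q := ball_integral (fun _ : 'I_d -> R => 1).
have hs : 0 <= s by lra.
(* The error constant depends only on [s], not on the subdivision, so [e] can tend to 0. *)
pose C := (P s + f0 * Q s) * M s.
have C0 : 0 <= C.
  apply: Rmult_le_pos; last exact: ball_integral_ge0.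
  apply: Rplus_le_le_0_compat; first exact: ball_integral_ge0.
  by apply: Rmult_le_pos => //; apply: ball_integral_ge0.
suff key e : 0 < e -> A s * M r <= A r * M s + e * C.
  apply: le_epsilon => e he.
  have h : 0 < e / (1 + C) by apply: Rdiv_lt_0_compat; lra.
  apply: Rle_trans (key _ h) _; apply: Rplus_le_compat_l.
  rewrite /Rdiv Rmult_assoc -[X in _ <= X]Rmult_1_r; apply: Rmult_le_compat_l; first lra.
  by rewrite Rmult_comm; apply/Rle_div_l; lra.
move=> he.
case: (@Heine_cor2 rho 0 s (fun x _ => rho_c x) (mkposreal e he)) => -[del hdel] /= hrho.
case: (geometric_nodes r s del (conj hr hrs) hdel) => q [K [N [hq hqs hqK hqN]]].
pose u i := r / q ^ K * q ^ i.
have qp i : 0 < q ^ i by apply: pow_lt; lra.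
have uS i : u i.+1 = q * u i by rewrite /u /=; ring.
have u0 i : 0 < u i by apply: Rmult_lt_0_compat => //; apply: Rdiv_lt_0_compat.
have um i : u i <= u i.+1 by rewrite uS; have := u0 i; nra.
have umn i n : u i <= u (i + n)%nat.
  elim: n => [|n ih]; first by rewrite addn0; lra.
  by rewrite addnS; have := um (i + n)%nat; lra.
have uK : u K = r by rewrite /u; field; have := qp K; lra.
have uN : u (K + N)%nat = s by [].
have us i : (i <= K + N)%nat -> u i <= s.
  by move=> hi; rewrite -uN -(subnKC hi); apply: umn.
have ui i : 0 <= u i by apply: Rlt_le.
have ui' i : 0 <= u i <= u i.+1 by [].
have hq' : 1 <= q by lra.
have hD : 1 < q ^ d by case: (d) hd => // k _; apply: Rlt_pow_R1 => //; lia.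
have c0 : Rabs (u 0%nat) < del.
  by rewrite Rabs_pos_eq // /u /= Rmult_1_r.
have near0 t : 0 <= t <= u 0%nat -> Rabs (rho t - rho (u 0%nat)) <= e.
  move=> [t0 t1]; have hu := us 0%nat (leq0n _); have h0 := u0 0%nat.
  move: c0; rewrite Rabs_pos_eq // => c0.
  by apply: Rlt_le; apply: hrho; try lra; apply: Rabs_def1; lra.
have neari i : (i < K + N)%nat -> forall t, u i < t <= u i.+1 ->
    Rabs (rho t - rho (u i.+1)) <= e.
  move=> hi t [t0 t1]; have hu := us _ hi; have h0 := u0 i.
  have hus : (q - 1) * u i <= (q - 1) * s.
    by apply: Rmult_le_compat_l; [lra | exact: us (ltnW hi)].
  have hgap : u i.+1 - u i < del by rewrite uS; lra.
  by apply: Rlt_le; apply: hrho; try lra; apply: Rabs_def1; lra.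
rewrite -uK -uN /C -uN.
(* The weight on a shell is [rho] at its outer radius; [f0], a bound for [f], bounds the shell
   averages. *)
apply: (weighted_chebyshev (P \o u) (Q \o u) (A \o u) (M \o u)
  (fun i => rho (u i.+1)) (rho (u 0%nat)) (q ^ d)) => //=.
- lra.
- exact: ball_integral_ge0.
- exact: ball_integral_ge0.
- exact: ball_integral_ge0.
- by move=> i; apply: ball_integral_mono.
- by move=> i; rewrite uS; apply: ball_volume_scale; lra || done.
- by move=> i; apply: ball_integral_mono.
- by rewrite uS; apply: ball_dilate => // x; apply: hdec.
- by move=> i; rewrite (uS i.+1) [in X in _ - X <= _]uS; apply: shell_dilate => // x; apply: hdec.
- move=> i.
  have h1 := shell_int f _ _ hd (ui i) (ui i.+1) hf f_0.
  have h2 := shell_int (fun _ => 1) _ _ hd (ui i) (ui i.+1) hone one0.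
  have := has_int_le _ _ _ _ _ h1 (has_int_lin _ _ f0 0 _ _ h2 (has_int_zero d)).
  rewrite /P /Q => h; rewrite -[X in _ <= X]Rplus_0_r -[X in _ <= _ + X](Rmult_0_r 0).
  apply: Rle_trans (h _) _; last by right; ring.
  move=> x; have [a1 a2] := hfb x; have := ball_ind_mono _ _ x (um i); nra.
- exact: ball_approx.
- exact: ball_approx.
- by move=> i hi; apply: shell_approx => //; exact: neari.
- by move=> i hi; apply: shell_approx => //; exact: neari.
Qed.

(* Only the star-shapedness of the superlevel sets with respect to the origin
   enters the argument. *)
Lemma class_C_radial {d : nat} (f : ('I_d -> R) -> R) :
  class_C d f -> forall q x, 1 <= q -> f (fun i => q * x i) <= f x.
Proof.
move=> [_ [_ [f0 [fconv fmax]]]] q x hq; apply: Rnot_lt_le => hlt.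
(* If [f] increased from [x] to [q x], the level [c] would be exceeded at [q x] and at the maximum
   point 0, but not at [x], which lies between them. *)
pose c := (f x + f (fun i => q * x i)) / 2.
have hfx := f0 x; have hc : 0 < c by rewrite /c; lra.
have ht : 0 <= / q <= 1.
  split; first by apply/Rlt_le/Rinv_0_lt_compat; lra.
  by rewrite -Rinv_1; apply: Rinv_le_contravar; lra.
have := fconv c hc (fun i => q * x i) (vzero d) (/ q) _ _ ht.
rewrite (_ : (fun i => / q * (q * x i) + (1 - / q) * vzero d i) = x); last first.
  by apply: functional_extensionality => i; rewrite /vzero; field; lra.
have := fmax (fun i => q * x i) => hm h.
have : c < f x by apply: h; rewrite /c; lra.
by rewrite /c; lra.
Qed.

(** [rho] is controlled only on nonnegative arguments; its even extension is continuous on the whole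
    line and agrees with it on norms. *)
Lemma continuity_pt_comp_Rabs (rho : R -> R) :
  (forall t, 0 <= t -> limit1_in rho (fun s => 0 <= s) (rho t) t) ->
  forall t, continuity_pt (fun s => rho (Rabs s)) t.
Proof.
move=> h t; apply/continuity_pt_filterlim.
apply/filterlim_locally => e.
case: (h (Rabs t) (Rabs_pos t) e (cond_pos e)) => del [hdel H].
exists (mkposreal del hdel) => y hy; apply: H; split; first exact: Rabs_pos.
apply: Rle_lt_trans hy; exact: Rabs_triang_inv2.
Qed.

Theorem theorem2p1 (d : nat) (hd : (1 <= d)%nat) (rho : R -> R)
  (rho_cont : forall t, 0 <= t -> limit1_in rho (fun s => 0 <= s) (rho t) t)
  (rho_pos : forall t, 0 <= t -> 0 < rho t)
  (rho_prob : int_Rd d (fun x => rho (vnorm d x)) 1)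
  (f : ('I_d -> R) -> R) (hf : class_C d f)
  (r : R) (hr : 0 <= r) :
  exists I J m,
    int_Rd d (fun x => f x * ball_ind d r x * rho (vnorm d x)) I /\
    int_Rd d (fun x => f x * rho (vnorm d x)) J /\
    int_Rd d (fun x => ball_ind d r x * rho (vnorm d x)) m /\
    J * m <= I.
Proof.
pose rh t := rho (Rabs t).
have erho x : rh (vnorm d x) = rho (vnorm d x).
  by rewrite /rh Rabs_pos_eq //; exact: vnorm_ge0.
have rh_c : forall t, continuity_pt rh t by exact: continuity_pt_comp_Rabs.
have rh0 t : 0 <= rh t by apply/Rlt_le/rho_pos/Rabs_pos.
have hdec := class_C_radial f hf.
case: hf => /cont_Rd_scont fc [[M0 fsupp] [f0 [_ fmax]]].
have hrn : scont (fun x => rh (vnorm d x)).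
  apply: (scont_comp (vnorm d) rh (scont_vnorm d)) => x.
  by apply/continuity_pt_filterlim.
have hfr := scont_mult _ _ fc hrn.
have h1r := scont_mult _ _ (scont_const d 1) hrn.
have fr0 x : 0 <= f x * rh (vnorm d x) by apply: Rmult_le_pos.
have r0 x : 0 <= 1 * rh (vnorm d x) by rewrite Rmult_1_l.
(* Beyond [s] the function [f] vanishes, so its full integral is the one over the ball of radius
   [s]. *)
pose s := Rmax M0 r + 1.
have s1 : M0 < s by have := Rmax_l M0 r; rewrite /s; lra.
have s2 : r < s by have := Rmax_r M0 r; rewrite /s; lra.
have hs : 0 <= s by lra.
have hA t : 0 <= t -> _ := fun ht => ball_integralP _ t hd ht hfr fr0.
have hM t : 0 <= t -> _ := fun ht => ball_integralP _ t hd ht h1r r0.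
set A := ball_integral _ in hA; set M := ball_integral _ in hM.
have A0 : 0 <= A r by exact: ball_integral_ge0.
have Ms0 : 0 <= M s by exact: ball_integral_ge0.
(* The mass of the ball is compared with the integral of [rho] over one cube that is large enough
   for both. *)
have Ms : M s <= 1.
  apply: le_epsilon => e he; case: (rho_prob e he) => R0 hR0.
  case: (hM s hs) => r1 hr1 hI.
  case: (hR0 (Rmax R0 r1) (Rmax_l _ _)) => Ir [hIr /Rabs_lt_between hb].
  have m2 := Rmax_r R0 r1.
  have : M s <= Ir.
    apply: (cube_int_le _ _ (Rmax R0 r1) _ _ _ _ (hI _ m2) hIr); first lra.
    by move=> x; rewrite -erho; have := rh0 (vnorm d x); case: (ball_ind_bounds s x); nra.
  lra.
exists (A r), (A s), (M r); split; [|split; [|split]].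
- apply: has_int_int_Rd; apply: has_int_ext (hA r hr) => x.
  by rewrite erho; ring.
- apply: has_int_int_Rd; apply: has_int_ext (hA s hs) => x.
  rewrite erho; case: (Rle_lt_dec (vnorm d x) s) => hx.
    by rewrite ball_ind_in // Rmult_1_r.
  by rewrite fsupp; [ring | lra].
- apply: has_int_int_Rd; apply: has_int_ext (hM r hr) => x.
  by rewrite erho; ring.
(* For [r = 0] the ball is a point and has measure 0. *)
case: hr => [hr|hr0]; last first.
  have -> : M r = 0.
    apply: has_int_unique (hM r _) _; first lra.
    by rewrite -hr0; apply: ball_int_zero.
  by rewrite Rmult_0_r.
apply: Rle_trans (radial_correlation rh f (f (vzero d)) r s hd rh_c rh0 fc _ hdec (conj hr s2)) _.
  by move=> x; split.
(* [A r * M s] is at most [A r], because [M s <= 1] and [A r] is nonnegative. *)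
rewrite -/A -/M; nra.
Qed.
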